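(* Let $n\geq 1$, $u_T\in \mathrm{Lip}(\mathbb{R}^n)$ and $T>0$, and let $I_T(u_T)=\{u_0\in\mathrm{Lip}(\mathbb{R}^n): S_T^+u_0=u_T\}$, where $S_T^+$ is the forward solution operator associated with the Hamiltonian $H$. (1) If $n=1$ and $H\in C^2(\mathbb{R})$ satisfies $H_{pp}(p)>0$ for all $p\in\mathbb{R}$ and $\lim_{|p|\to\infty}H(p)/|p|=+\infty$, then $I_T(u_T)\ne\emptyset$ if and only if $u_T$ satisfies $$\partial_{xx}u_T-\big(T\,H_{pp}(\partial_xu_T)\big)^{-1}\le 0\quad\text{in }\mathbb{R}$$ in the viscosity sense. (2) If $n\ge1$ and $H(p)=\frac{\langle Ap,p\rangle}{2}$ for a symmetric positive definite $n\times n$ matrix $A$, then $I_T(u_T)\neq\emptyset$ if and only if $u_T$ satisfies $$\lambda_n\Big[D^2u_T-\frac{A^{-1}}{T}\Big]\le 0\quad\text{in }\mathbb{R}^n$$ in the viscosity sense.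
   Context: $\mathrm{Lip}(\mathbb{R}^n)$ is the set of (globally) Lipschitz continuous functions $\mathbb{R}^n\to\mathbb{R}$. $H_p,H_{pp}$ denote gradient and Hessian of $H$. For a symmetric $n\times n$ matrix $X$, $\lambda_n[X]$ is its largest eigenvalue. Viscosity sense of the inequalities: $u_T$ satisfies $\lambda_n\big[D^2u_T-\frac{[H_{pp}(Du_T)]^{-1}}{T}\big]\le0$ in the viscosity sense if for every twice-differentiable function $\phi:\mathbb{R}^n\to\mathbb{R}$, $$\lambda_n\Big[D^2\phi(x)-\frac{[H_{pp}(\nabla\phi(x))]^{-1}}{T}\Big]\le0\quad\text{whenever }x\text{ is a local minimum of }u_T-\phi.$$ For $n=1$ this is the inequality in (1); for $H(p)=\langle Ap,p\rangle/2$ one has $H_{pp}\equiv A$ and it is the inequality in (2). Viscosity solution of the evolution equation: a uniformly continuous $u:[0,T]\times\mathbb{R}^n\to\mathbb{R}$ is a viscosity solution of $\partial_t u+H(D_xu)=0$ if for every $\varphi\in C^\infty([0,T]\times\mathbb{R}^n)$ and $(t_0,x_0)\in(0,T)\times\mathbb{R}^n$: $\partial_t\varphi(t_0,x_0)+H(\nabla_x\varphi(t_0,x_0))\le 0$ whenever $(t_0,x_0)$ is a local maximum of $u-\varphi$, and $\ge 0$ whenever it is a local minimum of $u-\varphi$. For $u_0\in\mathrm{Lip}(\mathbb{R}^n)$, $S_T^+u_0:=u(T,\cdot)\in\mathrm{Lip}(\mathbb{R}^n)$, where $u$ is the unique viscosity solution with $u(0,\cdot)=u_0$. With $L(q)=\max_{p\in\mathbb{R}^n}[q\cdot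 p-H(p)]$, it is given by the well-known Hopf–Lax formula $S_T^+u_0(x)=\min_{y\in\mathbb{R}^n}\big[u_0(y)+T\,L\big(\frac{x-y}{T}\big)\big]$. *)

(* Defs.v *)
From HB Require Import structures.
From mathcomp Require Import all_boot all_order all_algebra.
From mathcomp Require Import all_classical all_reals all_analysis.
Set Implicit Arguments.
Unset Strict Implicit.
Unset Printing Implicit Defensive.
Import Order.TTheory GRing.Theory Num.Theory.
Import numFieldNormedType.Exports.
Local Open Scope classical_set_scope.
Local Open Scope ring_scope.

(* The norm of the library on 'rV[R]_n is the sup norm; Lipschitz continuity,
   uniform continuity, differentiability, growth at infinity and local extrema
   do not depend on the choice of a norm. *)

Section calculus.
Context {R : realType}.

(* In finite dimension this is the usual class C^k: all partial derivatives of
   order at most k exist and are continuous. *)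
Fixpoint Ck (V : normedModType R) (k : nat) (f : V -> R) : Prop :=
  match k with
  | 0%N => continuous f
  | k'.+1 => (forall x, differentiable f x) /\ (forall v, Ck k' ('D_v f))
  end.

Definition Cinfty (V : normedModType R) (f : V -> R) : Prop :=
  forall k, Ck k f.

Definition gradient n (f : 'rV[R]_n -> R) (x : 'rV[R]_n) : 'rV[R]_n :=
  \row_(i < n) 'D_(delta_mx 0 i) f x.

Definition hessian n (f : 'rV[R]_n -> R) (x : 'rV[R]_n) : 'M[R]_n :=
  \matrix_(i < n, j < n)
    'D_(delta_mx 0 i) ('D_(delta_mx 0 j) f : 'rV[R]_n -> R) x.

Definition twice_differentiable n (f : 'rV[R]_n -> R) : Prop :=
  (forall x, differentiable f x) /\ (forall x, differentiable (gradient f) x).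

Definition local_min (T : topologicalType) (f : T -> R) (x : T) : Prop :=
  \forall y \near x, f x <= f y.

Definition local_max (T : topologicalType) (f : T -> R) (x : T) : Prop :=
  \forall y \near x, f y <= f x.

(* <Ap, p>, with p a row vector *)
Definition quad n (A : 'M[R]_n) (p : 'rV[R]_n) : R := (p *m A *m p^T) 0 0.

(* For a symmetric matrix of size n >= 1 the set of real eigenvalues is finite
   and nonempty, so this supremum is a maximum. *)
Definition lambda_max n (X : 'M[R]_n) : R := sup [set a : R | eigenvalue X a].

Definition superlinear n (H : 'rV[R]_n -> R) : Prop :=
  forall M : R, exists r : R,
    forall p : 'rV[R]_n, r < `|p| -> M < H p / `|p|.

End calculus.

Section hamilton_jacobi.
Context {R : realType} {n : nat}.
Local Notation V := ('rV[R]_n).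

(* F(Du, D^2 u) <= 0 in the viscosity sense; for these inequalities the test
   functions touch u from below. *)
Definition viscosity_le0 (F : V -> 'M[R]_n -> R) (u : V -> R) : Prop :=
  forall phi : V -> R, twice_differentiable phi ->
  forall x : V, local_min (u \- phi) x ->
    F (gradient phi x) (hessian phi x) <= 0.

Definition unif_continuous_strip (T : R) (u : R * V -> R) : Prop :=
  forall e : R, 0 < e -> exists2 d : R, 0 < d &
    forall (t s : R) (x y : V), 0 <= t <= T -> 0 <= s <= T ->
      `|t - s| < d -> `|x - y| < d -> `|u (t, x) - u (s, y)| < e.

(* Only the values of u on [0, T] x R^n matter: (t0, x0) is interior to that
   strip, so local extrema may be taken in R x R^n. A smooth function on the
   closed strip is the restriction of a smooth function on R x R^n, whence the
   domain of the test functions. *)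
Definition viscosity_solution (H : V -> R) (T : R) (u : R * V -> R) : Prop :=
  unif_continuous_strip T u /\
  forall phi : R * V -> R, Cinfty phi ->
  forall (t0 : R) (x0 : V), 0 < t0 < T ->
    let residual := derive1 (fun t : R => phi (t, x0)) t0
                    + H (gradient (fun x : V => phi (t0, x)) x0) in
    (local_max (u \- phi) (t0, x0) -> residual <= 0) /\
    (local_min (u \- phi) (t0, x0) -> 0 <= residual).

(* The operator S_T^+. The solution with initial datum u0 is unique on
   [0, T] x R^n, so the value at time T does not depend on the choice made by
   get; this operator is only meaningful for Lipschitz u0. *)
Definition forward (H : V -> R) (T : R) (u0 : V -> R) : V -> R :=
  let u := get [set u : R * V -> R |
             viscosity_solution H T u /\ forall x, u (0, x) = u0 x] in
  fun x => u (T, x).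

(* The set I_T(uT) *)
Definition initial_data (H : V -> R) (T : R) (uT : V -> R) : set (V -> R) :=
  [set u0 | lipschitz u0 /\ forward H T u0 = uT].

End hamilton_jacobi.

(* Main.v *)
Require Import Defs.
From HB Require Import structures.
From mathcomp Require Import all_boot all_order all_algebra.
From mathcomp Require Import all_classical all_reals all_analysis.
From mathcomp Require Import ring lra.
Set Implicit Arguments.
Unset Strict Implicit.
Unset Printing Implicit Defensive.
Import Order.TTheory GRing.Theory Num.Theory.
Import numFieldNormedType.Exports.
Local Open Scope classical_set_scope.
Local Open Scope ring_scope.

(* The operator is given by the Hopf-Lax formula, whose value at time [T] is the
   only one a viscosity solution can take. The upper bound holds because, along
   a line of direction [q], convexity turns the equation into the linear
   inequality [u_t + q . Du <= L q]. The lower bound comes from comparing with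
   the classical solution [c - (T - t) L ((x - y) / (T - t))], which touches [u]
   from below up to a quadratic error; no doubling of variables is needed.

   If [uT] is reachable, it is touched from above at each [x] by
   [T L ((. - y) / T)] for a minimiser [y] of the Hopf-Lax formula, whence the
   second-order inequality. Conversely, take
   [u0 y := sup_x (uT x - T L ((x - y) / T))]. Then the Hopf-Lax function of [u0]
   dominates [uT], with equality at the points where some [T L ((. - y) / T)]
   touches [uT] globally from above. These points are dense: maximise
   [uT - k |. - x|^2] and upgrade the local touching to a global one, using the
   viscosity inequality, which says that [uT - <A^-1 x, x> / (2 T)] is concave in
   the quadratic case and that [uT - T L ((. - y) / T)] is quasiconcave for every
   [y] in dimension one. *)

(** * Euclidean structure of row vectors *)

(** [forward] picks its solution with [get], so nothing can be said about it before the Hopf-Lax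
    function is known to be a solution and every solution is known to agree with it at time [T]. A
    competing solution is only uniformly continuous and satisfies the equation only for [0 < t < T].
    Comparison therefore takes place on boxes that end at some [b < T], and [T] itself is reached by
    uniform continuity. Test functions must be smooth, while [L] is controlled only by one-sided
    quadratic bounds; these suffice because the equation sees first derivatives only. Both cases of
    the theorem share everything except the second-order bounds on [L] and the passage from local to
    global touching. In dimension one that passage meets a borderline: the Hessian of
    [T L ((. - y) / T)] is exactly the one which the viscosity inequality allows. Costs with a
    horizon [t < T] have a strictly larger Hessian, and [t] then tends to [T]. *)

Section dot_product.
Context {R : realType} {n : nat}.
Local Notation V := ('rV[R]_n.+1).
Implicit Types (x y z : V) (a : R).

(** The norm at hand is the sup norm, whose powers are not smooth. Penalties and test functions use
    this Euclidean product, and [norm_dotxx] and [dotxx_norm] compare the two. *)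
Definition dot x y : R := \sum_i x 0 i * y 0 i.

Lemma dotC x y : dot x y = dot y x.
Proof. by apply: eq_bigr => i _; rewrite mulrC. Qed.

Lemma dotDl x y z : dot (x + y) z = dot x z + dot y z.
Proof. by rewrite -big_split; apply: eq_bigr => i _; rewrite mxE mulrDl. Qed.

Lemma dotZl a x z : dot (a *: x) z = a * dot x z.
Proof. by rewrite mulr_sumr; apply: eq_bigr => i _; rewrite mxE mulrA. Qed.

Lemma dotNl x z : dot (- x) z = - dot x z.
Proof. by rewrite -scaleN1r dotZl mulN1r. Qed.

Lemma dotBl x y z : dot (x - y) z = dot x z - dot y z.
Proof. by rewrite dotDl dotNl. Qed.

Lemma dotDr z x y : dot z (x + y) = dot z x + dot z y.
Proof. by rewrite dotC dotDl !(dotC z). Qed.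

Lemma dotZr a z x : dot z (a *: x) = a * dot z x.
Proof. by rewrite dotC dotZl dotC. Qed.

Lemma dotNr z x : dot z (- x) = - dot z x.
Proof. by rewrite dotC dotNl dotC. Qed.

Lemma dotBr z x y : dot z (x - y) = dot z x - dot z y.
Proof. by rewrite dotDr dotNr. Qed.

Lemma dot0l x : dot 0 x = 0.
Proof. by rewrite -(scale0r x) dotZl mul0r. Qed.

Lemma dot0r x : dot x 0 = 0.
Proof. by rewrite dotC dot0l. Qed.

Definition dotE := (dotDl, dotDr, dotNl, dotNr, dotZl, dotZr, dot0l, dot0r).

Lemma coord_le_norm x i : `|x 0 i| <= `|x|.
Proof.
rewrite {2}/Num.Def.normr/= mx_normrE.
exact: (le_bigmax_cond 0 (j := (0, i)) (fun k : 'I_1 * 'I_n.+1 => `|x k.1 k.2|)).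
Qed.

Lemma normr_le_coord x : exists i, `|x| = `|x 0 i|.
Proof.
have [->|x0] := eqVneq x 0; first by exists 0; rewrite mxE !normr0.
have /mx_norm_neq0 [[j i] /= e] : mx_norm x != 0.
  by apply: contra x0 => /eqP /mx_norm_eq0 ->.
by exists i; rewrite {1}/Num.Def.normr/= e (ord1 j).
Qed.

Lemma dot_delta x i : dot x (delta_mx 0 i) = x 0 i.
Proof.
rewrite /dot (bigD1 i)//= mxE !eqxx mulr1 big1 ?addr0// => j /negPf ji.
by rewrite mxE ji andbF mulr0.
Qed.

Lemma dot_norm_le x y : `|dot x y| <= n.+1%:R * `|x| * `|y|.
Proof.
apply: le_trans (ler_norm_sum _ _ _) _.
apply: (@le_trans _ _ (\sum_(i < n.+1) `|x| * `|y|)).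
  by apply: ler_sum => i _; rewrite normrM ler_pM ?coord_le_norm.
by rewrite sumr_const card_ord -[leLHS]mulr_natl mulrA.
Qed.

Lemma dotxx_ge0 x : 0 <= dot x x.
Proof. by apply: sumr_ge0 => i _; rewrite -expr2 sqr_ge0. Qed.

Lemma norm_dotxx x : `|x| ^+ 2 <= dot x x.
Proof.
have [i ->] := normr_le_coord x.
rewrite /dot (bigD1 i)//= real_normK ?num_real// -expr2 lerDl.
by apply: sumr_ge0 => j _; rewrite -expr2 sqr_ge0.
Qed.

Lemma dotxx_norm x : dot x x <= n.+1%:R * `|x| ^+ 2.
Proof. by rewrite (le_trans (ler_norm _))// expr2 mulrA dot_norm_le. Qed.

Lemma dotxx_sqrD x y : dot (x + y) (x + y) = dot x x + 2 * dot x y + dot y y.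
Proof. by rewrite !dotE (dotC y x); ring. Qed.

Lemma dotxxD x y : dot (x + y) (x + y) <= 2 * dot x x + 2 * dot y y.
Proof.
have := dotxx_ge0 (x - y); rewrite !dotE (dotC y x) => h; lra.
Qed.

(** With [a] a time increment and [x] a space increment, this bounds the deviation from a line of
    velocity [y] by the parabolic distance [dist2]. *)
Lemma dotxx_shift_le a x y :
  dot (x - a *: y) (x - a *: y) <= 2 * (1 + dot y y) * (a ^+ 2 + dot x x).
Proof.
have := dotxxD x (- (a *: y)); rewrite dotNr dotNl opprK dotZl dotZr.
have := mulr_ge0 (dotxx_ge0 x) (dotxx_ge0 y).
have := dotxx_ge0 x; have := sqr_ge0 a; nra.
Qed.

Lemma dot_continuous (T : topologicalType) (f g : T -> V) :
  continuous f -> continuous g -> continuous (fun t => dot (f t) (g t)).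
Proof.
move=> cf cg t; rewrite /dot; apply: cvg_big => [|i _].
  by apply: add_continuous.
apply: cvgM.
- exact: (continuous_comp (cf t) (@coord_continuous _ _ _ 0 i _)).
- exact: (continuous_comp (cg t) (@coord_continuous _ _ _ 0 i _)).
Qed.

End dot_product.

(** * Calculus *)

Section elementary_analysis.
Context {R : realType}.

Lemma lipschitzP (V : normedModType R) (f : V -> R) :
  lipschitz f <->
  exists2 K : R, 0 < K & forall x y, `|f x - f y| <= K * `|x - y|.
Proof.
split=> [[M [_ HM]]|[K K0 HK]].
  exists (`|M| + 1); first by rewrite ltr_wpDl.
  have : M < `|M| + 1 by rewrite (le_lt_trans (ler_norm _))// ltrDl.
  by move=> /HM h x y; apply: (h (x, y)).
by exists K; split; [exact: num_real|move=> M KM [x y] _ /=;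
  rewrite (le_trans (HK _ _))// ler_wpM2r// ltW].
Qed.

Lemma nearP (V : normedModType R) (x : V) (P : V -> Prop) :
  (\forall y \near x, P y) <->
  exists2 e : R, 0 < e & forall y, `|y - x| < e -> P y.
Proof.
split=> [/nbhs_normP[e e0 h]|[e e0 h]].
  by exists e => // y yx; apply: h; rewrite /ball_/= distrC.
by apply/nbhs_normP; exists e => // y; rewrite /ball_/= distrC => /h.
Qed.

Lemma near_pairP (V : normedModType R) (t : R) (x : V) (P : R * V -> Prop) :
  (\forall z \near (t, x), P z) <->
  exists2 e : R, 0 < e &
    forall s y, `|s - t| < e -> `|y - x| < e -> P (s, y).
Proof.
split=> [/nearP[e e0 h]|[e e0 h]].
  exists e => // s y st yx; apply: h.
  by rewrite prod_normE/= gt_max st yx.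
apply/nearP; exists e => // -[s y]; rewrite prod_normE/= gt_max => /andP[].
exact: h.
Qed.

Lemma continuousP (V : normedModType R) (f : V -> R) x :
  {for x, continuous f} <->
  forall e, 0 < e -> exists2 d : R, 0 < d &
    forall y, `|y - x| < d -> `|f y - f x| < e.
Proof.
split=> [/cvgrPdist_lt cf e e0|h].
  have /nearP[d d0 hd] := cf e e0.
  by exists d => // y /hd; rewrite distrC.
apply/cvgrPdist_lt => e e0; have [d d0 hd] := h e e0.
by apply/nearP; exists d => // y /hd; rewrite distrC.
Qed.

Lemma lipschitz_continuous (V : normedModType R) (f : V -> R) K :
  0 < K -> (forall x y, `|f x - f y| <= K * `|x - y|) -> continuous f.
Proof.
move=> K0 HK x; apply/continuousP => e e0; exists (e / K).
  by rewrite divr_gt0.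
move=> y; rewrite ltr_pdivlMr// => h.
by rewrite (le_lt_trans (HK _ _))// mulrC.
Qed.

(** Quadratic functions come with exact expansions, so their derivatives are read off from the
    remainder instead of being assembled by differentiation rules. *)
Lemma is_derive_quad_error (V : normedModType R) (f : V -> R) x v a M :
  (\forall h \near (0 : R), `|f (h *: v + x) - f x - h * a| <= M * h ^+ 2) ->
  is_derive x v f a.
Proof.
move=> /nearP[e e0 fM].
have lim_a : h^-1 *: ((f \o shift x) (h *: v) - f x) @[h --> 0^'] --> a.
  apply/cvgrPdist_le => d d0.
  near=> h.
  have h0 : h != 0 by near: h; exact: nbhs_dnbhs_neq.
  have he : `|h| < e by near: h; exact: dnbhs0_lt.
  have hd : `|h| < d / (`|M| + 1).
    by near: h; apply: dnbhs0_lt; rewrite divr_gt0// ltr_wpDl.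
  have := fM h; rewrite subr0 => /(_ he) h1.
  rewrite /= -(ler_pM2l (_ : 0 < `|h|)) ?normr_gt0// -normrM.
  have -> : h * (a - h^-1 *: (f (h *: v + x) - f x)) =
            - (f (h *: v + x) - f x - h * a).
    by rewrite mulrBr /GRing.scale/= mulrA divff// mul1r [RHS]opprB.
  rewrite normrN (le_trans h1)// -(real_normK (num_real h)) expr2 mulrA mulrC.
  rewrite ler_wpM2l//.
  move: hd; rewrite ltr_pdivlMr ?ltr_wpDl// => hd.
  apply: (le_trans _ (ltW hd)); rewrite mulrC ler_wpM2l//.
  by rewrite (le_trans (ler_norm _))// lerDl.
by split; [apply/cvg_ex; exists a|exact: cvg_lim lim_a].
Unshelve. all: by end_near. Qed.

End elementary_analysis.

(* Over an abstract topological space: [cvgD] and its analogues unfold the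
   neighborhood filter of a concrete matrix type. *)
Section continuity.
Context {R : realType} {S : topologicalType} {V : normedModType R}.
Implicit Types (a b : S -> R) (f g : S -> V).

Lemma cst_cont (c : V) : continuous (fun _ : S => c).
Proof. by move=> x; exact: cvg_cst. Qed.

Lemma addr_cont f g : continuous f -> continuous g -> continuous (fun x => f x + g x).
Proof. by move=> cf cg x; apply: cvgD; [exact: cf|exact: cg]. Qed.

Lemma subr_cont f g : continuous f -> continuous g -> continuous (fun x => f x - g x).
Proof. by move=> cf cg x; apply: cvgB; [exact: cf|exact: cg]. Qed.

Lemma scaler_cont a f : continuous a -> continuous f -> continuous (fun x => a x *: f x).
Proof. by move=> ca cf x; apply: cvgZ; [exact: ca|exact: cf]. Qed.

Lemma mulr_cont a b : continuous a -> continuous b -> continuous (fun x => a x * b x).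
Proof. by move=> ca cb x; apply: cvgM; [exact: ca|exact: cb]. Qed.

Lemma invr_cont a : (forall x, a x != 0) -> continuous a -> continuous (fun x => (a x)^-1).
Proof. by move=> a0 ca x; apply: cvgV => //; exact: ca. Qed.

Lemma comp_cont (S' : topologicalType) (h : S -> S') (k : S' -> V) :
  continuous h -> continuous k -> continuous (fun x => k (h x)).
Proof. by move=> ch ck x; exact: (continuous_comp (ch x) (ck _)). Qed.

End continuity.

Section smooth_functions.
Context {R : realType} {V : normedModType R}.
Implicit Types (f g : V -> R) (k : nat).

Lemma Ck_cst k (c : R) : Ck k (cst c : V -> R).
Proof.
elim: k c => [|k IH] c; first exact: cst_continuous.
split=> [x|v]; first exact: differentiable_cst.
suff -> : 'D_v (cst c : V -> R) = cst 0 by exact: IH.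
by apply/funext => x; exact: derive_cst.
Qed.

Lemma CkS k f : Ck k.+1 f -> Ck k f.
Proof.
elim: k f => [|k IH] f [df Df].
  by move=> x; exact: differentiable_continuous.
by split=> // v; exact/IH/Df.
Qed.

Lemma CkD k f g : Ck k f -> Ck k g -> Ck k (f \+ g).
Proof.
elim: k f g => [|k IH] f g; first by move=> cf cg x; apply: cvgD; [exact: cf|exact: cg].
move=> [df Df] [dg Dg]; split=> [x|v]; first exact: differentiableD.
suff -> : 'D_v (f \+ g) = 'D_v f \+ 'D_v g by exact: IH (Df v) (Dg v).
by apply/funext => x; rewrite deriveD//; exact: diff_derivable.
Qed.

Lemma CkM k f g : Ck k f -> Ck k g -> Ck k (f \* g).
Proof.
elim: k f g => [|k IH] f g; first by move=> cf cg x; apply: cvgM; [exact: cf|exact: cg].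
move=> Cf Cg; move: (Cf) (Cg) => [df Df] [dg Dg].
split=> [x|v]; first exact: differentiableM.
suff -> : 'D_v (f \* g) = (f \* 'D_v g) \+ (g \* 'D_v f).
  by apply: CkD; apply: IH; [exact: CkS|exact: Dg|exact: CkS|exact: Df].
by apply/funext => x; rewrite deriveM//; exact: diff_derivable.
Qed.

Lemma Ck_sum k m (f : 'I_m -> V -> R) :
  (forall i, Ck k (f i)) -> Ck k (fun x => \sum_i f i x).
Proof.
move=> Cf; elim: m f Cf => [|m IH] f Cf.
  suff -> : (fun x => \sum_i f i x) = cst 0 by exact: Ck_cst.
  by apply/funext => x; rewrite big_ord0.
suff -> : (fun x => \sum_i f i x) =
    f ord0 \+ (fun x => \sum_(i < m) f (lift ord0 i) x).
  by apply: CkD; [exact: Cf|apply: IH].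
by apply/funext => x; rewrite big_ord_recl.
Qed.

Lemma Ck_linear k (f : {linear V -> R}) : continuous f -> Ck k f.
Proof.
move=> cf; case: k => [//|k]; split=> [x|v].
  exact: linear_differentiable.
suff -> : 'D_v f = cst (f v) by exact: Ck_cst.
apply/funext => x; rewrite deriveE; last exact: linear_differentiable.
by rewrite diff_lin.
Qed.

End smooth_functions.

Section directional_derivatives.
Context {R : realType}.

Lemma is_derive_line (V : normedModType R) (f : V -> R) x v s :
  differentiable f (x + s *: v) ->
  is_derive s 1 (fun r : R => f (x + r *: v)) ('D_v f (x + s *: v)).
Proof.
move=> df.
have eqf : (fun h : R => h^-1 *: (((fun r : R => f (x + r *: v)) \o shift s) (h *: 1)
    - f (x + s *: v))) =
    (fun h : R => h^-1 *: ((f \o shift (x + s *: v)) (h *: v) - f (x + s *: v))).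
  apply/funext => h /=; congr (_ *: (f _ - _)).
  by rewrite [h *: 1]mulr1 scalerDl addrCA.
by split; [rewrite /derivable eqf; exact: diff_derivable|rewrite /derive eqf].
Qed.

Section row_vectors.
Context {n : nat}.
Local Notation V := ('rV[R]_n.+1).

Lemma derive_gradient (f : V -> R) x v :
  differentiable f x -> 'D_v f x = dot (gradient f x) v.
Proof.
move=> df; rewrite deriveE// {1}[v]row_sum_delta linear_sum/=.
by apply: eq_bigr => i _; rewrite linearZ/= mxE deriveE// mulrC.
Qed.

Lemma differentiable_coord_comp (f : V -> V) x i :
  differentiable f x -> differentiable (fun z => f z 0 i) x.
Proof.
move=> df.
exact: (differentiable_comp df (@differentiable_coord _ _ _ (f x) 0 i)).
Qed.

Lemma is_derive_gradient_line (phi : V -> R) x v :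
  twice_differentiable phi ->
  is_derive (0 : R) 1 (fun s : R => dot (gradient phi (x + s *: v)) v)
    (dot (v *m hessian phi x) v).
Proof.
move=> [dphi dgrad].
have dg j : is_derive (0 : R) 1
    (fun s : R => (gradient phi (x + s *: v)) 0 j * v 0 j)
    ((v *m hessian phi x) 0 j * v 0 j).
  have dgj : differentiable (fun z => gradient phi z 0 j) x.
    exact: differentiable_coord_comp.
  have := @is_derive_line _ (fun z => gradient phi z 0 j) x v 0.
  rewrite scale0r addr0 => /(_ dgj) Dj.
  suff -> : (v *m hessian phi x) 0 j = 'D_v (fun z => gradient phi z 0 j) x.
    have := is_deriveM Dj (is_derive_cst (v 0 j) (0 : R) 1).
    by move/is_derive_eq; apply; rewrite scaler0 add0r [LHS]mulrC.
  rewrite derive_gradient// mxE; apply: eq_bigr => i _.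
  rewrite !mxE mulrC; congr (_ * _).
  by congr ('D_(delta_mx 0 i) _ x); apply/funext => z; rewrite mxE.
have -> : (fun s : R => dot (gradient phi (x + s *: v)) v) =
    \sum_(j < n.+1) (fun s : R => (gradient phi (x + s *: v)) 0 j * v 0 j).
  by apply/funext => s; rewrite fct_sumE.
exact: is_derive_sum.
Qed.

End row_vectors.

Lemma is_derive_epsilon (g : R -> R) (D e : R) :
  is_derive (0 : R) 1 g D -> 0 < e ->
  exists2 d : R, 0 < d & forall s : R, 0 < `|s| -> `|s| < d ->
    `|g s - g 0 - s * D| < e * `|s|.
Proof.
move=> gD e0.
have : h^-1 *: ((g \o shift 0) (h *: 1) - g 0) @[h --> 0^'] --> D.
  by have [dg <-] := gD; exact: dg.
move=> /cvgrPdist_lt/(_ e e0); rewrite /dnbhs /within/= => /nearP[d d0 hd].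
exists d => // s; rewrite normr_gt0 => s0 sd.
have := hd s; rewrite subr0 => /(_ sd s0).
rewrite addr0 [s *: 1]mulr1 -[_ < e](ltr_pM2r (_ : 0 < `|s|)) ?normr_gt0//.
rewrite -normrM mulrBl [_ *: _ * s]mulrAC mulVf// mul1r -normrN opprB.
by rewrite (mulrC s).
Qed.

(** Writing the intermediate point as a fraction [th] of the way makes the formula independent of
    the order of [a] and [b]; when they coincide any fraction works. *)
Lemma MVT_between (g dg : R -> R) (a b : R) :
  (forall s : R, is_derive s 1 g (dg s)) ->
  exists th : R, 0 < th < 1 /\ g b - g a = dg (a + th * (b - a)) * (b - a).
Proof.
move=> g'E.
have lt_case (x y : R) : x < y ->
    exists th : R, 0 < th < 1 /\ g y - g x = dg (x + th * (y - x)) * (y - x).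
  move=> xy; have yx : 0 < y - x by rewrite subr_gt0.
  have [c] : exists2 c, c \in `]x, y[ & g y - g x = dg c * (y - x).
    apply: MVT => //; apply: continuous_subspaceT => s.
    by apply: (@differentiable_continuous _ R R); apply/derivable1_diffP.
  rewrite in_itv/= => /andP[xc cy] ->; exists ((c - x) / (y - x)); split.
    by rewrite divr_gt0 ?subr_gt0// ltr_pdivrMr// mul1r ltrD2r.
  by rewrite divfK ?gt_eqF// [x + _]addrC subrK.
have [/lt_case//|/lt_case[th [/andP[th0 th1] E]]|->] := ltgtP a b; last first.
  by exists (1 / 2); rewrite !subrr mulr0; split=> //; apply/andP; split; lra.
exists (1 - th); split; first by apply/andP; split; lra.
have -> : a + (1 - th) * (b - a) = b + th * (a - b) by ring.
by rewrite -[LHS]opprB E; ring.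
Qed.

(** The mean value theorem is applied to the remainder [k], whose derivative is the first-order
    error of [dg] at 0. Hence the second derivative is needed at 0 only, which matches test
    functions that are merely twice differentiable. *)
Lemma taylor2 (g dg : R -> R) (d2 e : R) :
  (forall s : R, is_derive s 1 g (dg s)) -> is_derive (0 : R) 1 dg d2 -> 0 < e ->
  exists2 d : R, 0 < d & forall r : R, `|r| < d ->
    `|g r - g 0 - r * dg 0 - d2 / 2 * r ^+ 2| <= e * r ^+ 2.
Proof.
move=> g'E dg'E e0; have [d d0 hd] := is_derive_epsilon dg'E e0.
exists d => // r rd.
pose k s := g s - s * dg 0 - d2 / 2 * s ^+ 2.
have k'E (s : R) : is_derive s 1 k (dg s - dg 0 - s * d2).
  by rewrite /k; apply: is_derive_eq; rewrite /GRing.scale/=; field.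
have [th [/andP[th0 th1]]] := MVT_between 0 r k'E.
rewrite add0r subr0 /k mul0r expr0n/= mulr0 !subr0 => kr.
have -> : g r - g 0 - r * dg 0 - d2 / 2 * r ^+ 2 =
    (dg (th * r) - dg 0 - th * r * d2) * r by rewrite -kr; ring.
have [->|r0] := eqVneq r 0; first by rewrite mulr0 expr0n/= mulr0 normr0.
rewrite normrM -(real_normK (num_real r)) expr2 mulrA ler_pM2r ?normr_gt0//.
have thr : `|th * r| <= `|r|.
  by rewrite normrM gtr0_norm// ler_piMl// ltW.
have thr0 : 0 < `|th * r| by rewrite normr_gt0 mulf_neq0// gt_eqF.
apply: le_trans (ltW (hd _ thr0 (le_lt_trans thr rd))) _.
by rewrite ler_pM2l.
Qed.

Lemma second_derivative_le (g dg : R -> R) (d2 a : R) :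
  (forall s : R, is_derive s 1 g (dg s)) -> is_derive (0 : R) 1 dg d2 ->
  (\forall s \near (0 : R), g s <= g 0 + s * dg 0 + a / 2 * s ^+ 2) ->
  d2 <= a.
Proof.
move=> g'E dg'E /nearP[e e0 ge]; apply/ler_addgt0Pr => b b0.
have b2 : 0 < b / 2 by rewrite divr_gt0.
have [d d0 hd] := taylor2 g'E dg'E b2.
pose r := Num.min d e / 2.
have m0 : 0 < Num.min d e by rewrite lt_min d0.
have r0 : 0 < r by rewrite divr_gt0.
have : r < Num.min d e by rewrite /r ltr_pdivrMr// mulr_natr mulr2n ltrDl.
rewrite lt_min => /andP[rd re].
have := ge r; rewrite subr0 gtr0_norm// => /(_ re) up.
have := hd r; rewrite gtr0_norm// => /(_ rd); rewrite ler_norml => /andP[lo _].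
have r20 : 0 < r ^+ 2 by rewrite exprn_gt0.
by rewrite -(ler_pM2r r20); lra.
Qed.

End directional_derivatives.

(** * Quadratic and parabolic test functions *)

Section quadratic_tests.
Context {R : realType} {n : nat}.
Local Notation V := ('rV[R]_n.+1).

Definition qform (a : V) (S : 'M[R]_n.+1) (z : V) : R :=
  dot a z + dot (z *m S) z / 2.

Lemma differentiable_dot (f g : V -> V) x :
  differentiable f x -> differentiable g x ->
  differentiable (fun z => dot (f z) (g z)) x.
Proof.
move=> df dg.
have -> : (fun z => dot (f z) (g z)) = \sum_i (fun z => f z 0 i * g z 0 i).
  by apply/funext => z; rewrite fct_sumE.
by apply: differentiable_sum => i; apply: differentiableM; exact: differentiable_coord_comp.
Qed.

Lemma dot_mulmx (S : 'M[R]_n.+1) (x y : V) :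
  dot (x *m S) y = dot x (y *m S^T).
Proof.
have dE (u v : V) : dot u v = (u *m v^T) 0 0.
  by rewrite !mxE; apply: eq_bigr => i _; rewrite mxE.
by rewrite !dE trmx_mul trmxK mulmxA.
Qed.

Lemma qformD (a : V) (S : 'M[R]_n.+1) (x v : V) : S^T = S ->
  qform a S (v + x) = qform a S x + dot (a + x *m S) v + dot (v *m S) v / 2.
Proof.
move=> ST; rewrite /qform mulmxDl !dotE (dot_mulmx S x v) ST (dotC x (v *m S)).
by field.
Qed.

Lemma derive_qform (a : V) (S : 'M[R]_n.+1) (x v : V) : S^T = S ->
  'D_v (qform a S) x = dot (a + x *m S) v.
Proof.
move=> ST; suff : is_derive x v (qform a S) (dot (a + x *m S) v) by case.
apply: (@is_derive_quad_error _ _ _ _ _ _ (`|dot (v *m S) v / 2|)).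
apply/nearP; exists 1 => // h _; rewrite qformD// -scalemxAl !dotE.
rewrite -[h ^+ 2 in leRHS](ger0_norm (sqr_ge0 h)) -normrM.
rewrite le_eqVlt; apply/orP; left; apply/eqP; congr `|_|.
by field.
Qed.

Lemma gradient_qform (a : V) (S : 'M[R]_n.+1) (x : V) : S^T = S ->
  gradient (qform a S) x = a + x *m S.
Proof.
by move=> ST; apply/rowP => i; rewrite mxE derive_qform// dot_delta.
Qed.

Lemma hessian_qform (a : V) (S : 'M[R]_n.+1) (x : V) : S^T = S ->
  hessian (qform a S) x = S.
Proof.
move=> ST; apply/matrixP => i j; rewrite mxE.
have -> : 'D_(delta_mx 0 j) (qform a S) = fun z : V => (a + z *m S) 0 j.
  by apply/funext => z; rewrite derive_qform// dot_delta.
suff : is_derive x (delta_mx 0 i) (fun z : V => (a + z *m S) 0 j) (S i j) by case.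
apply: (@is_derive_quad_error _ _ _ _ _ _ 0); apply/nearP; exists 1 => // h _.
rewrite mul0r normr_le0 mulmxDl -scalemxAl -rowE !mxE; apply/eqP; ring.
Qed.

Lemma qform_twice_differentiable (a : V) (S : 'M[R]_n.+1) : S^T = S ->
  twice_differentiable (qform a S).
Proof.
move=> ST.
have dS (x : V) : differentiable (mulmxr S : V -> V) x.
  have -> : (mulmxr S : V -> V) = \sum_i (fun x : V => x 0 i *: row i S).
    by apply/funext => y; rewrite fct_sumE /= mulmx_sum_row.
  apply: differentiable_sum => i; apply: differentiableZl.
  exact: differentiable_coord.
split => x; last first.
  have -> : gradient (qform a S) = (fun z : V => cst a z + mulmxr S z).
    by apply/funext => z; rewrite gradient_qform.
  by apply: differentiableD => //; exact: differentiable_cst.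
apply: differentiableD.
  by apply: differentiable_dot; [exact: differentiable_cst|exact: ex_diff].
have -> : (fun z : V => dot (z *m S) z / 2) = 2^-1 *: (fun z : V => dot (mulmxr S z) z).
  by apply/funext => z; rewrite /= mulrC.
apply: differentiableZ; by apply: differentiable_dot => //; exact: ex_diff.
Qed.

End quadratic_tests.

Section parabolic_tests.
Context {R : realType} {n : nat}.
Local Notation V := ('rV[R]_n.+1).

Definition dist2 (t0 : R) (x0 : V) (z : R * V) : R :=
  (z.1 - t0) ^+ 2 + dot (z.2 - x0) (z.2 - x0).

Definition paraboloid (c al C t0 : R) (p x0 : V) (z : R * V) : R :=
  c + al * (z.1 - t0) + dot p (z.2 - x0) + C * dist2 t0 x0 z.

Lemma paraboloid_Cinfty (c al C t0 : R) (p x0 : V) :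
  Cinfty (paraboloid c al C t0 p x0).
Proof.
move=> k.
have C1 : Ck k (fun z : R * V => z.1 - t0).
  apply: (CkD (g := cst (- t0))); last exact: Ck_cst.
  by apply: (@Ck_linear _ _ _ fst) => z; exact: cvg_fst.
have C2 i : Ck k (fun z : R * V => (z.2 - x0) 0 i).
  pose f := (fun z : R * V => z.2 0 i) : R * V -> R.
  have lf : linear f by move=> b u v; rewrite /f /= !mxE.
  pose F := GRing.isLinear.Build R (R * V)%type R *%R f lf.
  pose g : {linear (R * V)%type -> R} := HB.pack f F.
  have -> : (fun z : R * V => (z.2 - x0) 0 i) = f \+ cst (- x0 0 i).
    by apply/funext => z; rewrite /f !mxE.
  apply: CkD; last exact: Ck_cst.
  apply: (@Ck_linear _ _ _ g) => z.
  apply: (continuous_comp (f := snd) (g := fun x : V => x 0 i)).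
    exact: cvg_snd.
  exact: coord_continuous.
apply: CkD; first apply: CkD; first apply: CkD.
- exact: Ck_cst.
- by apply: CkM => //; exact: Ck_cst.
- by apply: Ck_sum => i; apply: CkM => //; exact: Ck_cst.
- apply: CkM; first exact: Ck_cst.
  apply: CkD; last by apply: Ck_sum => i; exact: CkM.
  exact: CkM.
Qed.

Lemma paraboloid_derive1 (c al C t0 : R) (p x0 : V) :
  derive1 (fun t => paraboloid c al C t0 p x0 (t, x0)) t0 = al.
Proof.
rewrite derive1E.
suff : is_derive t0 1 (fun t => paraboloid c al C t0 p x0 (t, x0)) al by case.
apply: (@is_derive_quad_error _ _ _ _ _ _ `|C|).
apply/nearP; exists 1 => // h _; rewrite /paraboloid/dist2/= !subrr !dotE.
rewrite -[h ^+ 2 in leRHS](ger0_norm (sqr_ge0 h)) -normrM.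
rewrite le_eqVlt; apply/orP; left; apply/eqP; congr `|_|.
by rewrite [h *: 1]mulr1; ring.
Qed.

Lemma paraboloid_gradient (c al C t0 : R) (p x0 : V) :
  gradient (fun x => paraboloid c al C t0 p x0 (t0, x)) x0 = p.
Proof.
apply/rowP => i; rewrite mxE.
suff : is_derive x0 (delta_mx 0 i) (fun x => paraboloid c al C t0 p x0 (t0, x)) (p 0 i).
  by case.
apply: (@is_derive_quad_error _ _ _ _ _ _ `|C|).
apply/nearP; exists 1 => // h _; rewrite /paraboloid/dist2/= !subrr addrK !dotE.
rewrite -[h ^+ 2 in leRHS](ger0_norm (sqr_ge0 h)) -normrM !dot_delta mxE !eqxx.
rewrite le_eqVlt; apply/orP; left; apply/eqP; congr `|_|.
by rewrite /=; ring.
Qed.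

Section touching.
Variables (H : V -> R) (T : R) (u : R * V -> R).
Hypothesis Hu : viscosity_solution H T u.

(** The term in [dist2] has zero first derivatives at the contact point and can be moved into the
    test function. A comparison function thus needs only a one-sided quadratic expansion, not
    smoothness. *)
Lemma viscosity_touch_below (t0 al C e : R) (x0 p : V) :
  0 < t0 < T -> 0 < e ->
  (forall t x, `|t - t0| < e -> `|x - x0| < e ->
     u (t0, x0) + al * (t - t0) + dot p (x - x0) <=
       u (t, x) + C * dist2 t0 x0 (t, x)) ->
  0 <= al + H p.
Proof.
move=> t0T e0 touch.
have [_ /(_ _ (paraboloid_Cinfty (u (t0, x0)) al (- C) t0 p x0) t0 x0 t0T)] := Hu.
rewrite /= paraboloid_derive1 paraboloid_gradient => -[_]; apply.
apply/near_pairP; exists e => // t x te xe /=.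
have := touch t x te xe.
by rewrite /paraboloid /dist2/= !subrr !dotE; lra.
Qed.

Lemma viscosity_touch_above (t0 al C e : R) (x0 p : V) :
  0 < t0 < T -> 0 < e ->
  (forall t x, `|t - t0| < e -> `|x - x0| < e ->
     u (t, x) <= u (t0, x0) + al * (t - t0) + dot p (x - x0)
       + C * dist2 t0 x0 (t, x)) ->
  al + H p <= 0.
Proof.
move=> t0T e0 touch.
have [_ /(_ _ (paraboloid_Cinfty (u (t0, x0)) al C t0 p x0) t0 x0 t0T)] := Hu.
rewrite /= paraboloid_derive1 paraboloid_gradient => -[+ _]; apply.
apply/near_pairP; exists e => // t x te xe /=.
have := touch t x te xe.
by rewrite /paraboloid /dist2/= !subrr !dotE; lra.
Qed.

End touching.

End parabolic_tests.

(** * Convex duality *)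

Section minima.
Context {R : realType} {n : nat}.
Local Notation V := ('rV[R]_n.+1).

Lemma norm_ball_compact (x : V) (r : R) : compact [set y : V | `|y - x| <= r].
Proof.
apply: bounded_closed_compact.
  exists (`|x| + r); split; first exact: num_real.
  move=> M hM y /= yr; apply: ltW; apply: le_lt_trans hM.
  by have := ler_normD (y - x) x; rewrite subrK; lra.
have -> : [set y : V | `|y - x| <= r] = closed_ball_ Num.norm x r.
  by apply/seteqP; split => y /=; rewrite distrC.
exact: closed_closed_ball_.
Qed.

Lemma continuous_attains_min (f : V -> R) (x : V) (r : R) :
  continuous f -> (forall y, r < `|y - x| -> f x < f y) ->
  exists m, forall y, f m <= f y.
Proof.
move=> cf big.
have [r0|r0] := ltP r 0.
  exists x => y; have [->//|yx] := eqVneq y x.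
  by apply/ltW/big; rewrite (lt_trans r0)// normr_gt0 subr_eq0.
have [||m _ hm] := @compact_EVT_min _ _ f _ _ (@norm_ball_compact x r).
- by exists x => /=; rewrite subrr normr0.
- exact: continuous_subspaceT.
exists m => y; have [yr|yr] := leP `|y - x| r; first by apply: hm; rewrite inE.
apply: le_trans (ltW (big y yr)); apply: hm.
by rewrite inE/= subrr normr0.
Qed.

Lemma box_attains_min (f : R * V -> R) (a b : R) (x : V) (r : R) :
  continuous f -> a <= b -> 0 <= r ->
  exists t y, [/\ a <= t <= b, `|y - x| <= r &
    forall s z, a <= s <= b -> `|z - x| <= r -> f (t, y) <= f (s, z)].
Proof.
move=> cf ab r0.
have cK : compact ([set` `[a, b]] `*` [set y : V | `|y - x| <= r]).
  by apply: compact_setX; [exact: segment_compact|exact: norm_ball_compact].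
have [||[t y]] := @compact_EVT_min _ _ f _ _ cK.
- by exists (a, x); split; rewrite /= ?in_itv/= ?lexx// subrr normr0.
- exact: continuous_subspaceT.
rewrite inE/= => -[/=]; rewrite in_itv/= => tab yr hm; exists t, y; split=> // s z sab zr.
by apply: hm; rewrite inE; split; rewrite //= in_itv.
Qed.

End minima.

Section convex_duality.
Context {R : realType} {n : nat}.
Local Notation V := ('rV[R]_n.+1).

(** The Legendre transform with its maximiser [DL q] supplied as data, so that no supremum has to be
    handled; for a [convex_pair], [legendre_ge] confirms that it is the maximum. *)
Definition legendre (H : V -> R) (DL : V -> V) (q : V) : R :=
  dot q (DL q) - H (DL q).

(* [DH] and [DL] play the role of the gradients of [H] and of [legendre H DL];
   [legendre_le] says that the latter is C^{1,1} from above. *)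
Record convex_pair (H : V -> R) (DH DL : V -> V) : Prop := {
  DLK : forall q, DH (DL q) = q;
  DHK : forall p, DL (DH p) = p;
  convex_ge : forall p p', H p + dot (DH p) (p' - p) <= H p';
  legendre_le : forall q, exists C e : R, [/\ 0 <= C, 0 < e &
    forall h, `|h| < e -> legendre H DL (q + h) <=
      legendre H DL q + dot (DL q) h + C * dot h h] }.

Section pair.
Variables (H : V -> R) (DH DL : V -> V).
Hypothesis P : convex_pair H DH DL.
Local Notation L := (legendre H DL).

Lemma legendre_ge q p : dot q p - H p <= L q.
Proof.
have := convex_ge P (DL q) p; rewrite (DLK P) /legendre !dotE; lra.
Qed.

Lemma legendre_DH p : L (DH p) = dot (DH p) p - H p.
Proof. by rewrite /legendre (DHK P). Qed.

Lemma legendre_subgradient q q' : L q + dot (q' - q) (DL q) <= L q'.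
Proof.
by have := legendre_ge q' (DL q); rewrite {2}/legendre !dotE; lra.
Qed.

(** The perspective [t L (x / t)] is convex and positively homogeneous, hence subadditive.
    Concretely, the subgradient inequalities at the weighted mean [m] are added and their linear
    terms cancel. *)
Lemma perspective_convex (s t : R) (a b : V) : 0 < s -> 0 < t ->
  (s + t) * L ((s + t)^-1 *: (a + b)) <=
    s * L (s^-1 *: a) + t * L (t^-1 *: b).
Proof.
move=> s0 t0; have st0 : s + t != 0 by rewrite gt_eqF// addr_gt0.
set m := (s + t)^-1 *: (a + b).
have abE : a + b = (s + t) *: m by rewrite /m scalerA divff// scale1r.
have pers (r : R) c : 0 < r -> r * L m + dot (c - r *: m) (DL m) <= r * L (r^-1 *: c).
  move=> r0.
  have := legendre_subgradient m (r^-1 *: c).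
  rewrite -(ler_pM2l r0) mulrDr -dotZl scalerBr scalerA divff ?gt_eqF//.
  by rewrite scale1r.
have := lerD (pers s a s0) (pers t b t0).
suff : dot (a - s *: m) (DL m) + dot (b - t *: m) (DL m) = 0 by lra.
have -> : b = (s + t) *: m - a by rewrite -abE addrC addKr.
by rewrite scalerDl !dotE; ring.
Qed.

(** Test the Legendre inequality with the multiples [K] and [- K] of the basis vector that realises
    the sup norm of [q]. Only finitely many values of [H] occur, and they make up the constant. *)
Lemma legendre_superlinear (K : R) : 0 <= K ->
  exists2 C : R, 0 <= C & forall q, K * `|q| - C <= L q.
Proof.
move=> K0; pose e (i : 'I_n.+1) : V := delta_mx 0 i.
exists (\sum_i (`|H (K *: e i)| + `|H (- K *: e i)|)).
  by apply: sumr_ge0 => i _; rewrite addr_ge0.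
move=> q; have [i ->] := normr_le_coord q.
have : `|H (K *: e i)| + `|H (- K *: e i)| <=
  \sum_i (`|H (K *: e i)| + `|H (- K *: e i)|).
  by rewrite [leRHS](bigD1 i)//= lerDl sumr_ge0// => j _; rewrite addr_ge0.
have := legendre_ge q (K *: e i); have := legendre_ge q (- K *: e i).
rewrite !dotE !dot_delta.
have := ler_norm (H (K *: e i)); have := ler_norm (H (- K *: e i)).
have := normr_ge0 (H (K *: e i)); have := normr_ge0 (H (- K *: e i)).
case: (ler0P (q 0 i)) => _; lra.
Qed.

Lemma perspective_superlinear (K : R) : 0 <= K ->
  exists2 C : R, 0 <= C & forall (t : R) q, 0 < t ->
    K * `|q| - t * C <= t * L (t^-1 *: q).
Proof.
move=> /legendre_superlinear[C C0 hC]; exists C => // t q t0.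
have := hC (t^-1 *: q); rewrite -(ler_pM2l t0) mulrBr.
rewrite normrZ gtr0_norm ?invr_gt0//.
by have -> : t * (K * (t^-1 * `|q|)) = K * `|q| by field; rewrite gt_eqF.
Qed.

Lemma legendre_continuous : continuous L.
Proof.
move=> q; apply/continuousP => e e0.
have [C [d [C0 d0 hC]]] := legendre_le P q.
pose N : R := n.+1%:R * (`|DL q| + C).
have N0 : 0 <= N by rewrite mulr_ge0// addr_ge0.
exists (Num.min d (Num.min 1 (e / (N + 1)))).
  by rewrite !lt_min d0 ltr01 divr_gt0// ltr_wpDl.
move=> y; rewrite !lt_min => /and3P[yd y1].
rewrite ltr_pdivlMr ?ltr_wpDl// mulrDr mulr1 => yN.
have := hC (y - q) yd; rewrite addrC subrK => up.
have low := legendre_subgradient q y.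
have := dot_norm_le (DL q) (y - q); rewrite (dotC (DL q)) in up *.
rewrite ler_norml => /andP[d1 d2].
have d3 : C * dot (y - q) (y - q) <= C * n.+1%:R * `|y - q|.
  rewrite -mulrA ler_wpM2l// (le_trans (dotxx_norm _))// ler_wpM2l//.
  by rewrite expr2 ler_piMl// ltW.
have yq0 := normr_ge0 (y - q).
have C3 : 0 <= C * n.+1%:R * `|y - q| by rewrite !mulr_ge0.
move: yN; rewrite /N => yN.
rewrite ltr_norml; apply/andP; split; lra.
Qed.

(** The perspective [t L (x / t)] has gradient [(- H p, p)], so it solves the Hamilton-Jacobi
    equation; the upper expansion is the direction needed to touch a solution from below. *)
Lemma perspective_le (t1 : R) (x1 : V) : 0 < t1 ->
  let p := DL (t1^-1 *: x1) in
  exists C e : R, [/\ 0 <= C, 0 < e & forall t x,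
    `|t - t1| < e -> `|x - x1| < e -> 0 < t ->
    t * L (t^-1 *: x) <= t1 * L (t1^-1 *: x1) - H p * (t - t1)
      + dot p (x - x1) + C * dist2 t1 x1 (t, x)].
Proof.
move=> t10 p; set q := t1^-1 *: x1.
have [C [d [C0 d0 hC]]] := legendre_le P q.
(* The radius [e] keeps [t] above [t1 / 2] and [w / t] below [d]. The constant is then [2 C / t1], a
   bound for [C / t], times the factor [2 (1 + |q|^2)] of [dotxx_shift_le], in the Euclidean
   norm. *)
pose C' := 4 * C / t1 * (1 + dot q q).
pose e := Num.min (t1 / 2) (d * t1 / (2 * (1 + `|q|))).
have q1 : 0 < 1 + `|q| by rewrite ltr_pwDl.
have x1E : x1 = t1 *: q by rewrite /q scalerA divff ?gt_eqF// scale1r.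
exists C', e; split.
- by rewrite !mulr_ge0 ?invr_ge0 ?(ltW t10)// addr_ge0// dotxx_ge0.
- by rewrite lt_min !divr_gt0// ?mulr_gt0.
move=> t x; rewrite !lt_min => /andP[tt1 te] /andP[_ xe] t0.
have t2 : t1 / 2 < t by move: tt1; rewrite ltr_norml => /andP[]; lra.
(* The deviation from the ray of velocity [q]: along the ray itself the perspective is linear, so
   only [w] enters the expansion of [L]. *)
pose w := (x - x1) - (t - t1) *: q.
have wE : x = t *: q + w.
  by rewrite /w scalerBl -x1E; apply/rowP => i; rewrite !mxE; ring.
have : `|t^-1 *: w| < d.
  rewrite normrZ gtr0_norm ?invr_gt0// mulrC ltr_pdivrMr//.
  have w1 : `|w| <= `|x - x1| + `|t - t1| * `|q|.
    by rewrite /w -normrZ -[`|_ *: q|]normrN ler_normD.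
  move: te xe; rewrite !ltr_pdivlMr ?mulr_gt0// => te xe.
  have q0 := normr_ge0 q.
  have : (`|x - x1| + `|t - t1| * `|q|) * 2 < d * t1.
    rewrite -(ltr_pM2r q1).
    have te' : `|t - t1| * (2 * (1 + `|q|)) * `|q| <= d * t1 * `|q|.
      by rewrite ler_wpM2r// ltW.
    nra.
  have : d * (t1 / 2) < d * t by rewrite ltr_pM2l.
  lra.
move=> /hC; rewrite -(ler_pM2l t0).
have -> : q + t^-1 *: w = t^-1 *: x.
  rewrite [in RHS]wE; apply/rowP => i; rewrite !mxE.
  by field; rewrite !gt_eqF.
move=> h; apply: (le_trans h).
have tN0 : t != 0 by rewrite gt_eqF.
have -> : t * (L q + dot (DL q) (t^-1 *: w) + C * dot (t^-1 *: w) (t^-1 *: w)) =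
   t * L q + dot p w + C / t * dot w w.
  by rewrite !(dotZr _ _ w) dotZl /p -/q; field.
have ww : dot w w <= 2 * (1 + dot q q) * dist2 t1 x1 (t, x).
  exact: dotxx_shift_le.
have Ct : C / t * dot w w <= C' * dist2 t1 x1 (t, x).
  apply: (@le_trans _ _ (2 * C / t1 * dot w w)).
    rewrite ler_wpM2r ?dotxx_ge0// ler_pdivrMr// mulrAC ler_pdivlMr//.
    have := ler_wpM2l C0 (ltW t2); lra.
  apply: (@le_trans _ _ (2 * C / t1 * (2 * (1 + dot q q) * dist2 t1 x1 (t, x)))).
    by rewrite ler_wpM2l// !mulr_ge0 ?invr_ge0 ?(ltW t10).
  by rewrite /C' le_eqVlt; apply/orP; left; apply/eqP; field; rewrite gt_eqF.
rewrite -/q; apply: lerD => //.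
have -> : dot p w = dot p (x - x1) - (t - t1) * dot p q by rewrite /w !dotE.
have LH : L q = dot p q - H p by rewrite /legendre dotC.
by rewrite le_eqVlt; apply/orP; left; apply/eqP; rewrite LH; ring.
Qed.

End pair.
End convex_duality.

(** * The Hopf-Lax formula *)

Section hopf_lax_formula.
Context {R : realType} {n : nat}.
Local Notation V := ('rV[R]_n.+1).

Lemma derive_pair (phi : R * V -> R) (t0 : R) (x0 q : V) :
  differentiable phi (t0, x0) ->
  'D_(1, q) phi (t0, x0) = derive1 (fun t => phi (t, x0)) t0
    + dot (gradient (fun x => phi (t0, x)) x0) q.
Proof.
move=> dphi.
have dx : differentiable (fun x => phi (t0, x)) x0.
  have dp : differentiable (fun x : V => (t0, x)) x0.
    by apply: differentiable_pair; [exact: differentiable_cst|exact: ex_diff].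
  exact: (differentiable_comp dp dphi).
have -> : derive1 (fun t => phi (t, x0)) t0 = 'D_(1, 0) phi (t0, x0).
  rewrite /derive1 /derive; apply: (congr1 (fun f : R -> R => lim (f @ 0^'))); apply/funext => h /=.
  have -> : h *: (1, 0) + (t0, x0) = (h *: 1 + t0, h *: 0 + x0) :> R * V by [].
  by rewrite scaler0 add0r [h *: 1]mulr1.
rewrite -derive_gradient//.
have -> : 'D_q (fun x => phi (t0, x)) x0 = 'D_(0, q) phi (t0, x0).
  rewrite /derive; apply: (congr1 (fun f : R -> R => lim (f @ 0^'))); apply/funext => h /=.
  have -> : h *: (0, q) + (t0, x0) = (h *: 0 + t0, h *: q + x0) :> R * V by [].
  by rewrite [h *: 0]mulr0 add0r.
by rewrite !deriveE// -raddfD; congr ('d _ _ (_, _)); rewrite ?addr0 ?add0r.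
Qed.

(** The step goes backward in time because the dynamic programming principle relates a value to
    earlier ones. *)
Lemma derive_pair_backward (phi : R * V -> R) (t0 : R) (x0 q : V) (e : R) :
  differentiable phi (t0, x0) -> 0 < e ->
  exists2 d : R, 0 < d & forall h : R, 0 < h -> h < d ->
    `|phi (t0, x0) - phi (t0 - h, x0 - h *: q) -
      h * (derive1 (fun t => phi (t, x0)) t0
           + dot (gradient (fun x => phi (t0, x)) x0) q)| < e * h.
Proof.
move=> dphi e0; rewrite -derive_pair//.
have := @is_derive_line _ _ phi (t0, x0) (1, q) 0.
rewrite scale0r addr0 => /(_ dphi) D0.
have [d d0 hd] := is_derive_epsilon D0 e0.
exists d => // h h0 hdl; have := hd (- h).
rewrite normrN gtr0_norm// => /(_ h0 hdl).
rewrite scale0r addr0 -normrN; congr (`|_| < _).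
have -> : (t0, x0) + - h *: (1, q) = (t0 - h, x0 - h *: q) :> R * V.
  have -> : (t0, x0) + - h *: (1, q) = (t0 + - h *: 1, x0 + - h *: q) :> R * V by [].
  by rewrite !scaleNr [h *: 1]mulr1.
by ring.
Qed.

Lemma small_step (q : V) (d e t : R) : 0 < d -> 0 < e -> 0 < t ->
  exists h : R, [/\ 0 < h, h < d, h < t & forall r x,
    `|r - h - r| < e /\ `|x - h *: q - x| < e].
Proof.
move=> d0 e0 t0; have q1 : 0 < 1 + `|q| by rewrite ltr_pwDl.
pose m := Num.min d (Num.min t (e / (1 + `|q|))).
have m0 : 0 < m by rewrite !lt_min d0 t0 divr_gt0.
have : m / 2 < m by rewrite ltr_pdivrMr// mulr_natr mulr2n ltrDl.
rewrite {2}/m !lt_min => /and3P[hd ht]; rewrite ltr_pdivlMr// => he.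
have h0 : 0 < m / 2 by rewrite divr_gt0.
exists (m / 2); split=> // r x; have := normr_ge0 q => q0.
have -> : r - m / 2 - r = - (m / 2) by ring.
have -> : x - (m / 2) *: q - x = - ((m / 2) *: q) by apply/rowP => i; rewrite !mxE; ring.
have := mulr_ge0 (ltW h0) q0; move: he; rewrite mulrDr mulr1 => he hq0.
by split; rewrite normrN; [|rewrite normrZ]; rewrite gtr0_norm//; lra.
Qed.

Variables (H : V -> R) (DH DL : V -> V).
Hypothesis P : convex_pair H DH DL.
Local Notation L := (legendre H DL).

Variables (u0 : V -> R) (K : R).
Hypotheses (K0 : 0 < K) (u0K : forall x y, `|u0 x - u0 y| <= K * `|x - y|).

Definition hopf_lax_cost (t : R) (x y : V) : R :=
  u0 y + t * L (t^-1 *: (x - y)).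

(** At [t = 0] the cost would degenerate, [0^-1] being 0, so the initial datum is inserted by
    hand. *)
Definition hopf_lax (z : R * V) : R :=
  if z.1 <= 0 then u0 z.2 else inf (range (hopf_lax_cost z.1 z.2)).

Lemma hopf_lax_cost_min (t : R) (x : V) : 0 < t ->
  exists y, forall z, hopf_lax_cost t x y <= hopf_lax_cost t x z.
Proof.
(* Slope [K + 1] for the cost against at most [K] for [u0] leaves a net growth of rate 1, which
   makes the cost coercive in [y]. *)
move=> t0; have K10 : 0 <= K + 1 by rewrite addr_ge0// ltW.
have [C C0 hC] := perspective_superlinear P K10.
apply: (@continuous_attains_min _ _ _ x (t * C + t * L 0)).
  apply: addr_cont; first exact: lipschitz_continuous K0 u0K.
  apply: mulr_cont; first exact: cst_cont.
  apply: comp_cont (legendre_continuous P).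
  apply: scaler_cont; first exact: cst_cont.
  by apply: subr_cont; [exact: cst_cont|move=> y; exact: cvg_id].
move=> y yx; rewrite /hopf_lax_cost subrr scaler0.
have := hC t (x - y) t0.
have := u0K x y; rewrite ler_norml (distrC x y) => /andP[_].
lra.
Qed.

Lemma hopf_laxP (t : R) (x : V) : 0 < t ->
  exists y, hopf_lax (t, x) = hopf_lax_cost t x y /\
    forall z, hopf_lax (t, x) <= hopf_lax_cost t x z.
Proof.
move=> t0; have [y ymin] := hopf_lax_cost_min x t0.
have -> : hopf_lax (t, x) = hopf_lax_cost t x y.
  rewrite /hopf_lax/= leNgt t0/=; apply/eqP; rewrite eq_le; apply/andP; split.
    apply: ge_inf; last by exists y.
    by exists (hopf_lax_cost t x y) => _ [z _ <-]; exact: ymin.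
  apply: lb_le_inf; first by exists (hopf_lax_cost t x y), y.
  by move=> _ [z _ <-]; exact: ymin.
by exists y.
Qed.

Lemma hopf_lax_le (t : R) (x y : V) : 0 < t ->
  hopf_lax (t, x) <= u0 y + t * L (t^-1 *: (x - y)).
Proof. by move=> t0; have [_ [_]] := hopf_laxP x t0; apply. Qed.

Lemma hopf_lax0 (x : V) : hopf_lax (0, x) = u0 x.
Proof. by rewrite /hopf_lax/= lexx. Qed.

Lemma hopf_lax_lipschitz (t : R) (x y : V) :
  `|hopf_lax (t, x) - hopf_lax (t, y)| <= K * `|x - y|.
Proof.
have [t0|t0] := leP t 0; first by rewrite /hopf_lax/= t0.
have lip (a b : V) : hopf_lax (t, a) <= hopf_lax (t, b) + K * `|a - b|.
  have [c [-> _]] := hopf_laxP b t0.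
  (* The minimiser for [b] is translated along with the point: the velocity stays the same and only
     [u0] changes. *)
  have := hopf_lax_le a (c + (a - b)) t0.
  have -> : a - (c + (a - b)) = b - c by apply/rowP => i; rewrite !mxE; ring.
  have := u0K (c + (a - b)) c; rewrite addrAC subrr add0r.
  by rewrite /hopf_lax_cost ler_norml => /andP[]; lra.
have := lip x y; have := lip y x.
by rewrite distrC ler_norml => ? ?; apply/andP; split; lra.
Qed.

(** Going to [x - h *: q] and then following an optimal line is an admissible path, and by convexity
    the straight line from its foot costs no more. *)
Lemma hopf_lax_dpp_le (s h : R) (x q : V) : 0 <= s -> 0 < h ->
  hopf_lax (s + h, x) <= hopf_lax (s, x - h *: q) + h * L q.
Proof.
move=> s0 h0; have hq : q = h^-1 *: (h *: q).
  by rewrite scalerA mulVf ?gt_eqF// scale1r.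
have [->|sN0] := eqVneq s 0.
  rewrite add0r hopf_lax0; have := hopf_lax_le x (x - h *: q) h0.
  by rewrite subKr -hq.
have {sN0}s0 : 0 < s by rewrite lt_neqAle eq_sym sN0.
have [y [-> _]] := hopf_laxP (x - h *: q) s0.
apply: (le_trans (hopf_lax_le x y _)); first exact: addr_gt0.
rewrite /hopf_lax_cost -addrA lerD2l {2}hq.
have -> : x - y = (x - h *: q - y) + h *: q.
  by apply/rowP => i; rewrite !mxE; ring.
exact: perspective_convex P _ _ _ _ s0 h0.
Qed.

(** Cut the optimal straight line at time [s]; both pieces have its velocity [q]. *)
Lemma hopf_lax_dpp_ge (s h : R) (x : V) : 0 <= s -> 0 < h ->
  exists q, hopf_lax (s, x - h *: q) + h * L q <= hopf_lax (s + h, x).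
Proof.
move=> s0 h0; have sh0 : 0 < s + h by rewrite ltr_wpDl.
have [y [-> _]] := hopf_laxP x sh0.
rewrite /hopf_lax_cost; set q := (s + h)^-1 *: (x - y); exists q.
have xy : x - h *: q - y = s *: q.
  by rewrite /q; apply/rowP => i; rewrite !mxE; field; rewrite gt_eqF.
have [s00|sN0] := eqVneq s 0.
  move: (xy); rewrite s00 scale0r => /eqP; rewrite subr_eq0 => /eqP ->.
  by rewrite hopf_lax0 add0r.
have {sN0}s0 : 0 < s by rewrite lt_neqAle eq_sym sN0.
have := hopf_lax_le (x - h *: q) y s0.
by rewrite xy scalerK ?gt_eqF//; lra.
Qed.

(** Standing still, [q = 0], bounds the growth by [h L 0]. In the other direction the spatial change
    [K h |q|] is absorbed by the superlinearity of [L] with slope [K]. *)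
Lemma hopf_lax_time_lipschitz : exists2 M : R, 0 < M &
  forall s t x, 0 <= s -> 0 <= t ->
    `|hopf_lax (s, x) - hopf_lax (t, x)| <= M * `|s - t|.
Proof.
have [C C0 hC] := legendre_superlinear P (ltW K0).
exists (`|L 0| + C + 1); first by rewrite ltr_wpDl// addr_ge0.
move=> s t x.
wlog st : s t / s <= t.
  move=> hw s0 t0; have [|/ltW] := leP s t; first by move=> ?; exact: hw.
  by move=> ?; rewrite distrC (distrC s); exact: hw.
move=> s0 t0; have [->|sNt] := eqVneq s t; first by rewrite !subrr !normr0 mulr0.
pose h := t - s; have h0 : 0 < h by rewrite subr_gt0 lt_neqAle sNt.
have -> : t = s + h by rewrite /h addrC subrK.
have -> : `|s - (s + h)| = h by rewrite opprD addNKr normrN gtr0_norm.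
have := hopf_lax_dpp_le x 0 s0 h0; rewrite scaler0 subr0.
have [q] := hopf_lax_dpp_ge x s0 h0.
have := hopf_lax_lipschitz s (x - h *: q) x.
rewrite addrAC subrr add0r normrN normrZ gtr0_norm// !ler_norml => /andP[+ _].
have := ler_wpM2l (ltW h0) (hC q).
have := ler_wpM2l (ltW h0) (ler_norm (L 0)).
have := ler_wpM2l (ltW h0) (ler_norm (- L 0)); rewrite normrN.
have := mulr_ge0 (ltW h0) C0; have := mulr_ge0 (ltW h0) (normr_ge0 (L 0)).
by move=> *; apply/andP; split; lra.
Qed.

Lemma hopf_lax_viscosity_solution (T : R) : viscosity_solution H T hopf_lax.
Proof.
split.
  have [M M0 hM] := hopf_lax_time_lipschitz.
  move=> e e0; exists (e / (M + K)); first by rewrite divr_gt0// addr_gt0.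
  move=> t s x y /andP[t0 _] /andP[s0 _].
  rewrite !ltr_pdivlMr ?addr_gt0// => ts xy.
  have := hM t s x t0 s0; have := hopf_lax_lipschitz s x y.
  have := ler_normD (hopf_lax (t, x) - hopf_lax (s, x))
                    (hopf_lax (s, x) - hopf_lax (s, y)).
  rewrite addrA subrK.
  have [le|/ltW le] := leP `|t - s| `|x - y|.
    by have := ler_wpM2l (ltW M0) le; lra.
  by have := ler_wpM2l (ltW K0) le; lra.
move=> phi /(_ 1%N)[dphi _] t0 x0 /andP[t00 t0T] res; split.
  move=> /near_pairP[e e0 lmax].
  rewrite /res; set p := gradient _ _; set al := derive1 _ _.
  (* The velocity [DH p] turns the Legendre inequality into an equality, and the assumed excess
     [al + H p] serves as the tolerance in the expansion of [phi]. *)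
  rewrite leNgt; apply/negP => pos.
  have [d d0 hd] := derive_pair_backward (DH p) (dphi (t0, x0)) pos.
  have [h [h0 hhd ht he]] := small_step (DH p) d0 e0 t00.
  have [he1 he2] := he t0 x0.
  have := hd h h0 hhd; rewrite -/p -/al ltr_norml => /andP[+ _].
  have := lmax (t0 - h) (x0 - h *: DH p) he1 he2.
  have th0 : 0 <= t0 - h by rewrite subr_ge0 ltW.
  have := hopf_lax_dpp_le x0 (DH p) th0 h0.
  rewrite subrK (legendre_DH P) (dotC p) /=; nra.
move=> /near_pairP[e e0 lmin].
rewrite /res; set p := gradient _ _; set al := derive1 _ _.
rewrite leNgt; apply/negP => neg.
have [y [vy _]] := hopf_laxP x0 t00.
(* Going back along the optimal line leaves [y] and the velocity unchanged, so the value drops by at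
   least [h L q]. *)
pose q := t0^-1 *: (x0 - y).
have neg' : 0 < - (al + H p) by rewrite oppr_gt0.
have [d d0 hd] := derive_pair_backward q (dphi (t0, x0)) neg'.
have [h [h0 hhd ht he]] := small_step q d0 e0 t00.
have [he1 he2] := he t0 x0.
have := hd h h0 hhd; rewrite -/p -/al ltr_norml => /andP[_].
have := lmin (t0 - h) (x0 - h *: q) he1 he2.
have th0 : 0 < t0 - h by rewrite subr_gt0.
have := hopf_lax_le (x0 - h *: q) y th0.
have -> : (t0 - h)^-1 *: (x0 - h *: q - y) = q.
  rewrite /q; apply/rowP => i; rewrite !mxE; field.
  by rewrite !gt_eqF.
move: vy; rewrite /hopf_lax_cost -/q.
have := legendre_ge P q p; rewrite (dotC p) /=; nra.
Qed.

End hopf_lax_formula.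

(** * Uniqueness of viscosity solutions *)

Section uniqueness.
Context {R : realType} {n : nat}.
Local Notation V := ('rV[R]_n.+1).

Lemma dist_max_le (a s t : R) : `|Num.max a s - Num.max a t| <= `|s - t|.
Proof.
have := ler_norm (s - t); have := ler_norm (- (s - t)); rewrite normrN => h1 h2.
by case: (leP a s) => ?; case: (leP a t) => ?; rewrite ler_norml; apply/andP; split; lra.
Qed.

Lemma dist_min_le (s t a : R) : `|Num.min s a - Num.min t a| <= `|s - t|.
Proof.
have := ler_norm (s - t); have := ler_norm (- (s - t)); rewrite normrN => h1 h2.
by case: (leP s a) => ?; case: (leP t a) => ?; rewrite ler_norml; apply/andP; split; lra.
Qed.

(** A time penalty for interior minima: it vanishes at 0 and is at most [m] at [S], so it hardly
    disturbs the comparison there; it exceeds [M] at [b], which rules out the top face; its positive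
    slope makes the final inequality strict. The upper quadratic expansion lets it enter a
    paraboloid test. *)
Lemma barrier (S b m M : R) : 0 < S -> S < b -> 0 < m -> 0 <= M ->
  exists (th dth : R -> R) (B : R),
    [/\ continuous th, th 0 = 0 /\ (forall t, 0 <= t -> 0 <= th t),
        th S <= m /\ M <= th b,
        forall t, 0 <= t -> 0 < dth t &
        0 <= B /\ forall s t, th t <= th s + dth s * (t - s) + B * (t - s) ^+ 2].
Proof.
move=> S0 Sb m0 M0; pose B := M / (b - S) ^+ 2; pose a := m / S.
pose rp (t : R) := Num.max 0 (t - S).
have rp0 t : 0 <= rp t by rewrite le_max lexx.
have a0 : 0 < a by rewrite divr_gt0.
have bS : 0 < b - S by rewrite subr_gt0.
have B0 : 0 <= B by rewrite divr_ge0// sqr_ge0.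
exists (fun t => a * t + B * rp t ^+ 2), (fun t => a + 2 * B * rp t), B.
split=> [| | |t t0|].
- apply: addr_cont; first by apply: mulr_cont; [exact: cst_cont|move=> t; exact: cvg_id].
  apply: mulr_cont; first exact: cst_cont.
  have crp : continuous rp.
    move=> t; apply/continuousP => e e0; exists e => // s st.
    apply: le_lt_trans st; rewrite /rp.
    apply: le_trans (dist_max_le _ _ _) _.
    by have -> : s - S - (t - S) = s - t by ring.
  exact: (mulr_cont crp crp).
- split=> [|t t0]; last by rewrite addr_ge0// mulr_ge0 ?sqr_ge0// ltW.
  by rewrite /rp max_l ?sub0r ?oppr_le0 ?(ltW S0)// mulr0 expr0n mulr0 addr0.
- rewrite /rp subrr maxxx expr0n mulr0 addr0 /a divfK ?gt_eqF//; split=> //.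
  rewrite max_r ?(ltW bS)// /B divfK ?expf_neq0 ?gt_eqF//.
  by rewrite lerDr mulr_ge0 ?(ltW a0)// ltW// (lt_trans S0).
- by apply: ltr_wpDr a0; exact: mulr_ge0 (mulr_ge0 (ler0n _ 2) B0) (rp0 t).
split=> // s t.
suff : rp t ^+ 2 <= rp s ^+ 2 + 2 * rp s * (t - s) + (t - s) ^+ 2.
  by move=> /(ler_wpM2l B0); lra.
have -> : t - s = (t - S) - (s - S) by ring.
rewrite /rp; move: (s - S) (t - S) => x y.
case: (leP 0 x) => x0; case: (leP 0 y) => y0.
- by rewrite le_eqVlt; apply/orP; left; apply/eqP; ring.
- by have := sqr_ge0 y; lra.
- by have := mulr_ge0 y0 (ltW (_ : 0 < - x)); rewrite oppr_gt0 => /(_ x0); have := sqr_ge0 x; lra.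
- by have := sqr_ge0 (y - x); lra.
Qed.

Lemma box_interior_min (f : R * V -> R) (b r s0 : R) (x y0 : V) :
  continuous f -> 0 <= s0 <= b -> `|y0 - x| <= r ->
  (forall y, `|y - x| <= r -> f (s0, y0) < f (0, y)) ->
  (forall y, `|y - x| <= r -> f (s0, y0) < f (b, y)) ->
  (forall s y, 0 <= s <= b -> `|y - x| = r -> f (s0, y0) < f (s, y)) ->
  exists (t1 : R) (x1 : V) (e : R), [/\ 0 < t1 < b, 0 < e &
    forall t y, `|t - t1| < e -> `|y - x1| < e ->
      0 <= t <= b /\ f (t1, x1) <= f (t, y)].
Proof.
move=> cf s0b y0r f0 fb fr.
have r0 : 0 <= r by exact: le_trans y0r.
have b0 : 0 <= b by case/andP: s0b; exact: le_trans.
have [t1 [x1 [/andP[t10 t1b] x1r hm]]] := box_attains_min x cf b0 r0.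
have fm := hm _ _ s0b y0r.
have t1N0 : t1 != 0.
  by apply/eqP => t1E; have := f0 x1 x1r; rewrite -t1E ltNge fm.
have t1Nb : t1 != b.
  by apply/eqP => t1E; have := fb x1 x1r; rewrite -t1E ltNge fm.
have x1Nr : `|x1 - x| != r.
  by apply/eqP => /(fr t1 x1); rewrite t10 t1b => /(_ isT); rewrite ltNge fm.
have {t1N0}t10' : 0 < t1 by rewrite lt_neqAle eq_sym t1N0.
have {t1Nb}t1b' : 0 < b - t1 by rewrite subr_gt0 lt_neqAle t1Nb.
have {x1Nr}x1r' : 0 < r - `|x1 - x| by rewrite subr_gt0 lt_neqAle x1Nr.
exists t1, x1, (Num.min t1 (Num.min (b - t1) (r - `|x1 - x|))); split.
- by rewrite t10' -subr_gt0.
- by rewrite !lt_min t10' t1b'.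
move=> t y; rewrite !lt_min => /and3P[+ + _] /and3P[_ _ yr].
rewrite !ltr_norml => /andP[? ?] /andP[? ?].
have tb : 0 <= t <= b by apply/andP; split; lra.
split=> //; apply: hm => //.
by have := ler_normD (y - x1) (x1 - x); rewrite addrA subrK; lra.
Qed.

Section strip.
Variables (T : R) (u : R * V -> R).
Hypotheses (T0 : 0 < T) (uc : unif_continuous_strip T u).

(** [u] is controlled on the strip only. Freezing it in time outside gives a function continuous on
    the whole space, to which compactness applies. *)
Definition clamp (t : R) : R := Num.max 0 (Num.min t T).

Lemma clamp_id (t : R) : 0 <= t <= T -> clamp t = t.
Proof. by move=> /andP[t0 tT]; rewrite /clamp min_l// max_r. Qed.

Lemma clamp_itv (t : R) : 0 <= clamp t <= T.
Proof. by rewrite /clamp le_max lexx ge_max (ltW T0) ge_min lexx orbT. Qed.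

Lemma clamp_continuous : continuous (fun z : R * V => u (clamp z.1, z.2)).
Proof.
move=> [t x]; apply/cvgrPdist_lt => e e0.
have [d d0 hd] := uc e0.
apply/near_pairP; exists d => // s y st yx /=.
apply: hd; rewrite ?clamp_itv//; last by rewrite distrC.
rewrite distrC; apply: le_lt_trans st.
exact: le_trans (dist_max_le _ _ _) (dist_min_le _ _ _).
Qed.

(** Join the points by steps of length below the modulus for 1: each step costs at most 1 and their
    number grows linearly. This is the only control in space on a solution not known to be
    Lipschitz. *)
Lemma strip_linear_growth : exists2 A : R, 0 <= A &
  forall t x y, 0 <= t <= T -> `|u (t, x) - u (t, y)| <= A * (1 + `|x - y|).
Proof.
have [d d0 hd] := uc ltr01; pose c := d / 2.
have c0 : 0 < c by rewrite divr_gt0.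
have cd : c < d by rewrite /c ltr_pdivrMr// mulr_natr mulr2n ltrDl.
have chain (N : nat) t x y : 0 <= t <= T -> `|x - y| <= N%:R * c ->
    `|u (t, x) - u (t, y)| <= N%:R.
  move=> tT; elim: N x y => [|N IH] x y.
    by rewrite mul0r normr_le0 subr_eq0 => /eqP ->; rewrite subrr normr0.
  move=> xy; pose z := y + N.+1%:R^-1 *: (x - y).
  have zy : `|z - y| < d.
    rewrite /z addrAC subrr add0r normrZ gtr0_norm ?invr_gt0//.
    by apply: le_lt_trans cd; rewrite mulrC ler_pdivrMr// mulrC.
  have xz : `|x - z| <= N%:R * c.
    have -> : x - z = (N%:R / N.+1%:R) *: (x - y).
      rewrite /z; apply/rowP => i; rewrite !mxE -natr1; field.
      by rewrite natr1.
    rewrite normrZ ger0_norm ?divr_ge0// -mulrA ler_wpM2l//.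
    by rewrite mulrC ler_pdivrMr// mulrC.
  have := ler_normD (u (t, x) - u (t, z)) (u (t, z) - u (t, y)).
  rewrite addrA subrK => /le_trans; apply; rewrite -natr1 lerD//; first exact: IH.
  by apply/ltW/hd; rewrite ?subrr ?normr0.
exists (1 + c^-1); first by rewrite addr_ge0// invr_ge0 ltW.
move=> t x y tT.
have xy0 : 0 <= `|x - y| / c by rewrite divr_ge0// ltW.
have /andP[tr1 tr2] := truncn_itv xy0.
have := chain (Num.truncn (`|x - y| / c)).+1 t x y tT.
rewrite -ler_pdivrMr// => /(_ (ltW tr2)) h; apply: le_trans h _.
rewrite -natr1; have ci : 0 <= c^-1 by rewrite invr_ge0 ltW.
by have := normr_ge0 (x - y); lra.
Qed.

End strip.

Variables (H : V -> R) (DH DL : V -> V).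
Hypothesis P : convex_pair H DH DL.
Local Notation L := (legendre H DL).

Variables (u0 : V -> R) (K : R) (T : R) (u : R * V -> R).
Hypotheses (T0 : 0 < T) (K0 : 0 < K).
Hypothesis u0K : forall x y, `|u0 x - u0 y| <= K * `|x - y|.
Hypotheses (Hu : viscosity_solution H T u) (uu0 : forall x, u (0, x) = u0 x).

(* Along the line [y + t q] the equation only enters through the linear
   inequality [u_t + q . Du <= L q]. *)
Lemma viscosity_le_interior (S : R) (y q : V) : 0 < S < T ->
  u (S, y + S *: q) <= u0 y + S * L q.
Proof.
move=> /andP[S0 ST]; apply/ler_addgt0Pr => eta eta0.
rewrite leNgt; apply/negP => contra.
have [uc _] := Hu.
pose b := (S + T) / 2.
have Sb : S < b by rewrite /b ltr_pdivlMr//; lra.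
have bT : b < T by rewrite /b ltr_pdivrMr//; lra.
have b0 : 0 < b by exact: lt_trans Sb.
(* The line from [y] stays within [T |q|] of [y], so the lateral face is at distance at least 1 from
   it. *)
pose r := 1 + T * `|q|.
have Tq0 : 0 <= T * `|q| by rewrite mulr_ge0// ltW.
have r0 : 0 <= r by rewrite /r addr_ge0.
pose g (z : R * V) := u0 y + z.1 * L q - u (clamp T z.1, z.2).
have cg : continuous g.
  apply: subr_cont; last exact: clamp_continuous.
  apply: addr_cont; first exact: cst_cont.
  by apply: mulr_cont; [move=> z; exact: cvg_fst|exact: cst_cont].
have [tg [xg [_ _ gmin]]] := box_attains_min y cg (ltW b0) r0.
pose M := `|g (tg, xg)|.
have gM s z : 0 <= s <= b -> `|z - y| <= r -> - M <= g (s, z).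
  move=> sb zr; apply: le_trans (gmin s z sb zr).
  by rewrite lerNl (le_trans (ler_norm _))// normrN.
have M0 : 0 <= M by exact: normr_ge0.
have eta2 : 0 < eta / 2 by rewrite divr_gt0.
have [th [dth [B [cth [th0 thp] [thS thb] dth0 [B0 thB]]]]] := barrier S0 Sb eta2 M0.
(* The first summand absorbs the Lipschitz error of [u0] at [t = 0], up to [eta / 2]. The second
   beats the lower bound [- M] of [g] on the lateral face, where [w] has norm at least 1. *)
pose D := K ^+ 2 / (2 * eta) + (M + 1).
have KD : 0 <= K ^+ 2 / (2 * eta) by rewrite divr_ge0 ?sqr_ge0// mulr_ge0// ltW.
have D0 : 0 < D by rewrite ltr_wpDl// ltr_wpDl.
pose w (z : R * V) := z.2 - y - z.1 *: q.
pose f (z : R * V) := g z + th z.1 + D * dot (w z) (w z).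
have cf : continuous f.
  apply: addr_cont.
    apply: addr_cont cg _; apply: (comp_cont (h := fst)) cth.
    by move=> z; exact: cvg_fst.
  apply: mulr_cont; first exact: cst_cont.
  have cw : continuous w.
    apply: subr_cont.
      by apply: subr_cont; [move=> z; exact: cvg_snd|exact: cst_cont].
    by apply: scaler_cont; [move=> z; exact: cvg_fst|exact: cst_cont].
  exact: dot_continuous.
have cl s : 0 <= s <= b -> clamp T s = s.
  by move=> /andP[s0 sb]; rewrite clamp_id// s0 (le_trans sb)// ltW.
have Sb' : 0 <= S <= b by rewrite !ltW.
have fS : f (S, y + S *: q) < - (eta / 2).
  have -> : f (S, y + S *: q) = u0 y + S * L q - u (S, y + S *: q) + th S.
    have w0 : w (S, y + S *: q) = 0.
      by rewrite /w /=; apply/rowP => i; rewrite !mxE; ring.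
    by rewrite /f /g w0 /= (cl _ Sb') dot0l; ring.
  lra.
have [||||t1 [x1 [e [/andP[t10 t1b] e0 hmin]]]] :=
    @box_interior_min f b r S y (y + S *: q) cf Sb'.
- rewrite addrAC subrr add0r normrZ gtr0_norm// /r.
  have := ler_wpM2r (normr_ge0 q) (ltW ST); lra.
- move=> z zr; suff : - (eta / 2) <= f (0, z) by move: fS; lra.
  rewrite /f /g /w /= th0 scale0r subr0 mul0r !addr0 cl ?lexx ?(ltW b0)// uu0.
  have := u0K y z; rewrite ler_norml distrC => /andP[lo _].
  have := ler_wpM2l (ltW D0) (norm_dotxx (z - y)).
  move: lo; set X := `|z - y|; set Y := dot (z - y) (z - y) => lo hX.
  have : - (eta / 2) <= D * X ^+ 2 - K * X.
    have : 0 <= (K ^+ 2 / (2 * eta)) * X ^+ 2 - K * X + eta / 2.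
      have -> : K ^+ 2 / (2 * eta) * X ^+ 2 - K * X + eta / 2 =
        (K * X - eta) ^+ 2 / (2 * eta) by field; rewrite gt_eqF.
      by rewrite divr_ge0 ?sqr_ge0// mulr_ge0// ltW.
    have := mulr_ge0 (addr_ge0 M0 ler01) (sqr_ge0 X); rewrite /D; lra.
  lra.
- move=> z zr; suff : - (eta / 2) <= f (b, z) by move: fS; lra.
  have bb : 0 <= b <= b by rewrite lexx ltW.
  have := gM b z bb zr; have := mulr_ge0 (ltW D0) (dotxx_ge0 (w (b, z))).
  rewrite /f /=; lra.
- move=> s z sb zr; suff : - (eta / 2) <= f (s, z) by move: fS; lra.
  have /andP[s0 sb'] := sb.
  have := gM s z sb; rewrite zr lexx => /(_ isT) hg.
  have hth := thp s s0.
  have w1 : 1 <= `|w (s, z)|.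
    have := ler_normD (w (s, z)) (s *: q).
    rewrite {1}/w /= subrK zr normrZ ger0_norm// /r.
    have := ler_wpM2r (normr_ge0 q) (le_trans sb' (ltW bT)); lra.
  have : 1 <= dot (w (s, z)) (w (s, z)).
    by apply: le_trans (norm_dotxx _); rewrite exprn_ege1.
  move=> /(ler_wpM2l (ltW D0)); rewrite /f /= mulr1.
  have : M + 1 <= D by rewrite /D lerDr.
  lra.
pose w1 := w (t1, x1); pose p := (2 * D) *: w1.
have t1T : 0 < t1 < T by rewrite t10 (lt_trans t1b).
have t1b' : 0 <= t1 <= b by rewrite !ltW.
(* The slopes are those of [u0 y + t L q + th + D |w|^2]. The equation and [L q >= p . q - H p] then
   leave [dth t1 <= 0]. *)
have := @viscosity_touch_above _ _ H T u Hu t1 (L q + dth t1 - dot p q)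
  (B + 2 * D * (1 + dot q q)) e x1 p t1T e0.
have := legendre_ge P q p; rewrite (dotC q p) => Lge touch.
suff /touch : forall t x, `|t - t1| < e -> `|x - x1| < e ->
    u (t, x) <= u (t1, x1) + (L q + dth t1 - dot p q) * (t - t1)
      + dot p (x - x1) + (B + 2 * D * (1 + dot q q)) * dist2 t1 x1 (t, x).
  by have := dth0 t1 (ltW t10); lra.
move=> t x tt1 xx1; have [tb] := hmin t x tt1 xx1.
rewrite /f /g /= (cl _ tb) (cl _ t1b').
pose de := (x - x1) - (t - t1) *: q.
have -> : w (t, x) = w1 + de by rewrite /w1 /w /de /=; apply/rowP => i; rewrite !mxE; ring.
have pde : dot p de = 2 * D * dot w1 de by rewrite /p dotZl.
have pde' : dot p de = dot p (x - x1) - (t - t1) * dot p q by rewrite /de dotBr dotZr.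
have dde : dot de de <= 2 * (1 + dot q q) * dist2 t1 x1 (t, x).
  exact: dotxx_shift_le.
have := ler_wpM2l (ltW D0) dde; have := thB t1 t.
have : B * (t - t1) ^+ 2 <= B * dist2 t1 x1 (t, x).
  by rewrite ler_wpM2l// /dist2/= lerDl dotxx_ge0.
rewrite -/w1 (dotxx_sqrD w1).
have : D * (2 * dot w1 de) = dot p (x - x1) - (t - t1) * dot p q.
  by rewrite -pde' pde; ring.
move: (dist2 _ _ _) (dot w1 de) (dot de de) (dot w1 w1) => X1 X2 X3 X4; clear; lra.
Qed.

End uniqueness.

Section hopf_lax_uniqueness.
Context {R : realType} {n : nat}.
Local Notation V := ('rV[R]_n.+1).
Variables (H : V -> R) (DH DL : V -> V).
Hypothesis P : convex_pair H DH DL.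
Local Notation L := (legendre H DL).
Variables (u0 : V -> R) (K : R) (T : R) (u : R * V -> R).
Hypotheses (T0 : 0 < T) (K0 : 0 < K).
Hypothesis u0K : forall x y, `|u0 x - u0 y| <= K * `|x - y|.
Hypotheses (Hu : viscosity_solution H T u) (uu0 : forall x, u (0, x) = u0 x).

(* The comparison function [c - (T - t) L ((x - y) / (T - t))] is a classical
   solution on [t < T] which lies below [u0] at [t = 0]. *)
Lemma viscosity_ge_interior (S c : R) (x : V) : 0 < S < T ->
  (forall y, c <= u0 y + T * L (T^-1 *: (x - y))) ->
  c - (T - S) * L 0 <= u (S, x).
Proof.
move=> /andP[S0 ST] hc; apply/ler_addgt0Pr => eta eta0.
rewrite leNgt; apply/negP => contra.
have [uc _] := Hu.
pose b := (S + T) / 2.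
have Sb : S < b by rewrite /b ltr_pdivlMr//; lra.
have bT : b < T by rewrite /b ltr_pdivrMr//; lra.
have b0 : 0 < b by exact: lt_trans Sb.
have [A A0 hA] := strip_linear_growth uc.
(* Slope [A + 1] beats the spatial growth [A] of [u] and leaves a surplus of 1. *)
have [C C0 hC] := perspective_superlinear P (addr_ge0 A0 ler01).
have cu := clamp_continuous T0 uc.
(* With radius 0 the box is a time segment above [x], which gives a lower bound for [u] along it. *)
have [tm [xm [_ _ umin]]] := box_attains_min x cu (ltW b0) (lexx 0).
pose m := u (clamp T tm, xm).
have cl s : 0 <= s <= b -> clamp T s = s.
  by move=> /andP[s0 sb]; rewrite clamp_id// s0 (le_trans sb)// ltW.
have um s : 0 <= s <= b -> m <= u (s, x).
  by move=> sb; have := umin s x sb; rewrite subrr normr0 lexx /= (cl s sb); apply.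
(* Chosen so that [f - th] is at least [|y - x| - M]. The same [M] serves as the height of the
   barrier at [b] and as the radius of the box. *)
pose M := `|m| + A + `|c| + T * C.
have M0 : 0 <= M by rewrite !addr_ge0// mulr_ge0// ltW.
have eta2 : 0 < eta / 2 by rewrite divr_gt0.
have [th [dth [B [cth [th0 thp] [thS thb] dth0 [B0 thB]]]]] := barrier S0 Sb eta2 M0.
(* Equal to [T - t] up to time [b] and bounded away from 0 afterwards, so that [f] is continuous
   everywhere. *)
pose ta (t : R) := T - Num.min t b.
have taE t : 0 <= t <= b -> ta t = T - t by move=> /andP[_ tb]; rewrite /ta min_l.
have ta0 t : 0 < ta t by rewrite subr_gt0 gt_min bT orbT.
pose f (z : R * V) := u (clamp T z.1, z.2) - c
  + ta z.1 * L ((ta z.1)^-1 *: (x - z.2)) + th z.1.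
have cta : continuous (fun z : R * V => ta z.1).
  apply: subr_cont; first exact: cst_cont.
  have cmin : continuous (fun t : R => Num.min t b).
    move=> t; apply/continuousP => e e0; exists e => // s st.
    by apply: le_lt_trans st; exact: dist_min_le.
  by apply: (comp_cont (h := fst)) cmin; move=> z; exact: cvg_fst.
have cf : continuous f.
  apply: addr_cont; last first.
    by apply: (comp_cont (h := fst)) cth; move=> z; exact: cvg_fst.
  apply: addr_cont; first by apply: subr_cont; [exact: cu|exact: cst_cont].
  apply: mulr_cont => //; apply: comp_cont (legendre_continuous P).
  apply: scaler_cont; first by apply: invr_cont => // z; rewrite gt_eqF.
  by apply: subr_cont; [exact: cst_cont|move=> z; exact: cvg_snd].
have fE t y : 0 <= t <= b ->
    f (t, y) = u (t, y) - c + (T - t) * L ((T - t)^-1 *: (x - y)) + th t.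
  by move=> tb; rewrite /f /= cl// taE.
have fge t y : 0 <= t <= b -> `|y - x| - M <= f (t, y) - th t.
  move=> tb; rewrite fE// addrK.
  have tT : 0 < T - t by case/andP: tb => _ tb; rewrite subr_gt0 (le_lt_trans tb).
  have := hC (T - t) (x - y) tT; rewrite (distrC x y).
  have tT' : 0 <= t <= T by case/andP: tb => -> /le_trans; apply; exact: ltW.
  have := hA t y x tT'; rewrite ler_norml => /andP[+ _].
  have := um t tb; have := ler_norm (- m); have := ler_norm c.
  have : 0 <= t * C by case/andP: tb => ? _; rewrite mulr_ge0.
  rewrite normrN /M; lra.
have Sb' : 0 <= S <= b by rewrite !ltW.
have fS : f (S, x) < 0 by rewrite fE// subrr scaler0; lra.
have [||||t1 [y1 [e [/andP[t10 t1b] e0 hmin]]]] :=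
    @box_interior_min _ _ f b M S x x cf Sb'.
- by rewrite subrr normr0.
- move=> y _; apply: (lt_le_trans fS); rewrite fE ?lexx ?(ltW b0)//.
  by rewrite uu0 subr0 th0; have := hc y; lra.
- move=> y _; apply: (lt_le_trans fS).
  have := fge b y; rewrite lexx (ltW b0) => /(_ isT).
  have := normr_ge0 (y - x); lra.
- move=> t y tb yM; apply: (lt_le_trans fS).
  by have := fge t y tb; case/andP: tb => /thp; rewrite yM; lra.
have t1T : 0 < t1 < T by rewrite t10 (lt_trans t1b).
have t1b' : 0 <= t1 <= b by rewrite !ltW.
have Tt1 : 0 < T - t1 by rewrite subr_gt0 (lt_trans t1b).
have [C1 [d [C10 d0 hL]]] := perspective_le P (x - y1) Tt1.
set p := DL _ in hL.
pose e' := Num.min e d.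
have e'0 : 0 < e' by rewrite lt_min e0.
(* The comparison function solves the equation exactly, with time derivative [- H p]; the barrier
   leaves [0 <= - dth t1]. *)
have := @viscosity_touch_below _ _ H T u Hu t1 (- H p - dth t1) (C1 + B) e' y1 p t1T e'0.
suff touch : forall t y, `|t - t1| < e' -> `|y - y1| < e' ->
    u (t1, y1) + (- H p - dth t1) * (t - t1) + dot p (y - y1) <=
    u (t, y) + (C1 + B) * dist2 t1 y1 (t, y).
  by move=> /(_ touch); have := dth0 t1 (ltW t10); lra.
move=> t y; rewrite !lt_min => /andP[te td] /andP[ye yd].
have [tb] := hmin t y te ye; rewrite !fE//.
have Tt : 0 < T - t by case/andP: tb => _ tb; rewrite subr_gt0 (le_lt_trans tb).
have := hL (T - t) (x - y).
have -> : T - t - (T - t1) = - (t - t1) by ring.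
have -> : x - y - (x - y1) = - (y - y1) by apply/rowP => i; rewrite !mxE; ring.
rewrite !normrN => /(_ td yd Tt).
have -> : dist2 (T - t1) (x - y1) (T - t, x - y) = dist2 t1 y1 (t, y).
  rewrite /dist2/=; congr (_ + _); first by ring.
  have -> : x - y - (x - y1) = - (y - y1) by apply/rowP => i; rewrite !mxE; ring.
  by rewrite dotNl dotNr opprK.
rewrite dotNr; have := thB t1 t.
have : B * (t - t1) ^+ 2 <= B * dist2 t1 y1 (t, y).
  by rewrite ler_wpM2l// /dist2/= lerDl dotxx_ge0.
move: (dist2 _ _ _) => X; lra.
Qed.

(** Carries the interior estimates to time [T], where the equation itself says nothing; [y] is the
    velocity of the line along which [T] is approached. *)
Lemma viscosity_near_T (x y : V) (e : R) : 0 < e ->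
  exists2 d : R, 0 < d & forall S, 0 < S < T -> T - S < d ->
    `|u (T, x) - u (S, x + (S - T) *: y)| < e.
Proof.
move=> e0; have [uc _] := Hu; have [d d0 hd] := uc e e0.
have y1 : 0 < 1 + `|y| by rewrite ltr_pwDl.
exists (d / (1 + `|y|)); first by rewrite divr_gt0.
move=> S /andP[S0 ST]; rewrite ltr_pdivlMr// => hS.
have TS : 0 < T - S by rewrite subr_gt0.
have hy := mulr_ge0 (ltW TS) (normr_ge0 y).
apply: hd; rewrite ?lexx ?ltW//.
  by rewrite gtr0_norm//; lra.
rewrite opprD addNKr normrN normrZ distrC gtr0_norm//; lra.
Qed.

Lemma near_T (d : R) : 0 < d -> exists S, [/\ 0 < S < T, T - S < d & T - S < T].
Proof.
move=> d0; exists (T - Num.min d T / 2).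
have m0 : 0 < Num.min d T by rewrite lt_min d0.
have : Num.min d T <= d by rewrite ge_min lexx.
have : Num.min d T <= T by rewrite ge_min lexx orbT.
by move: (Num.min d T) m0 => m *; split; rewrite ?subKr; [apply/andP; split|..]; lra.
Qed.

Lemma viscosity_le_hopf_lax (x y : V) :
  u (T, x) <= u0 y + T * L (T^-1 *: (x - y)).
Proof.
set q := T^-1 *: (x - y).
apply/ler_addgt0Pr => e e0; have e2 : 0 < e / 2 by rewrite divr_gt0.
have [d d0 hd] := viscosity_near_T x q e2.
have L1 : 0 < 1 + `|L q| by rewrite ltr_pwDl.
have d'0 : 0 < Num.min d (e / 2 / (1 + `|L q|)).
  by rewrite lt_min d0 divr_gt0.
have [S [S0T + _]] := near_T d'0.
rewrite lt_min ltr_pdivlMr// => /andP[Sd Se].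
have := hd S S0T Sd.
have -> : x + (S - T) *: q = y + S *: q.
  by rewrite /q; apply/rowP => i; rewrite !mxE; field; rewrite gt_eqF.
have := viscosity_le_interior P T0 u0K Hu uu0 y q S0T.
have TS : 0 <= T - S by case/andP: S0T => _ /ltW; rewrite subr_ge0.
have := ler_wpM2l TS (ler_norm (- L q)); rewrite normrN.
rewrite ltr_norml => h1 h2 /andP[_ h3].
lra.
Qed.

Lemma viscosity_ge_hopf_lax (x : V) (c : R) :
  (forall y, c <= u0 y + T * L (T^-1 *: (x - y))) -> c <= u (T, x).
Proof.
move=> hc; apply/ler_addgt0Pr => e e0; have e2 : 0 < e / 2 by rewrite divr_gt0.
have [d d0 hd] := viscosity_near_T x 0 e2.
have L1 : 0 < 1 + `|L 0| by rewrite ltr_pwDl.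
have d'0 : 0 < Num.min d (e / 2 / (1 + `|L 0|)).
  by rewrite lt_min d0 divr_gt0.
have [S [S0T + _]] := near_T d'0.
rewrite lt_min ltr_pdivlMr// => /andP[Sd Se].
have := hd S S0T Sd; rewrite scaler0 addr0.
have := viscosity_ge_interior S0T hc.
have TS : 0 <= T - S by case/andP: S0T => _ /ltW; rewrite subr_ge0.
have := ler_wpM2l TS (ler_norm (L 0)).
rewrite ltr_norml => h1 h2 /andP[h3 _].
lra.
Qed.

Lemma viscosity_eq_hopf_lax (x : V) : u (T, x) = hopf_lax H DL u0 (T, x).
Proof.
have [y [yE yle]] := hopf_laxP P K0 u0K x T0.
apply/eqP; rewrite eq_le; apply/andP; split; last exact: viscosity_ge_hopf_lax.
by rewrite yE; exact: viscosity_le_hopf_lax.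
Qed.

End hopf_lax_uniqueness.

Section forward_operator.
Context {R : realType} {n : nat}.
Local Notation V := ('rV[R]_n.+1).

(** The Hopf-Lax function shows that [get] chooses from a nonempty set, and uniqueness fixes the
    value at [T] of whatever was chosen. *)
Lemma forward_hopf_lax (H : V -> R) (DH DL : V -> V) (u0 : V -> R) (T : R) :
  convex_pair H DH DL -> lipschitz u0 -> 0 < T ->
  forward H T u0 = fun x => hopf_lax H DL u0 (T, x).
Proof.
move=> P /lipschitzP[K K0 u0K] T0; apply/funext => x.
rewrite /forward.
have [] := @getPex _ [set u : R * V -> R |
    viscosity_solution H T u /\ forall x, u (0, x) = u0 x] _.
  exists (hopf_lax H DL u0); split; last by move=> z; exact: hopf_lax0.
  exact: (hopf_lax_viscosity_solution P K0 u0K).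
move=> Hu uu0.
exact: (viscosity_eq_hopf_lax P T0 K0 u0K Hu uu0).
Qed.

End forward_operator.

(** * Reachability *)

Section reachability.
Context {R : realType} {n : nat}.
Local Notation V := ('rV[R]_n.+1).

Lemma is_derive_touch (g : R -> R) (D a C : R) :
  is_derive (0 : R) 1 g D ->
  (\forall s \near (0 : R), g s <= g 0 + s * a + C * s ^+ 2) -> D = a.
Proof.
move=> gD /nearP[d d0 hd].
suff small (e : R) : 0 < e -> `|D - a| <= e.
  apply/eqP; rewrite -subr_eq0 -normr_le0; apply/ler_addgt0Pr => e /small.
  by rewrite add0r.
move=> e0; have e2 : 0 < e / 2 by rewrite divr_gt0.
have [d' d'0 hd'] := is_derive_epsilon gD e2.
pose C1 := 1 + `|C|; have C10 : 0 < C1 by rewrite ltr_pwDl.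
pose m := Num.min (Num.min d d') (e / C1).
have m0 : 0 < m by rewrite !lt_min d0 d'0 divr_gt0.
pose s := m / 2; have s0 : 0 < s by rewrite divr_gt0.
have sm : s < m by rewrite /s ltr_pdivrMr// mulr_natr mulr2n ltrDl.
have : m <= m by []; rewrite {2}/m !le_min => /andP[/andP[md md']].
have sd : s < d by exact: lt_le_trans md.
have sd' : s < d' by exact: lt_le_trans md'.
rewrite ler_pdivlMr// {1}(_ : m = 2 * s); last by rewrite /s; field.
move=> mC.
have sC : C * s ^+ 2 <= e / 2 * s.
  rewrite expr2 mulrA ler_pM2r//.
  have : C * s <= `|C| * s by rewrite ler_wpM2r ?ler_norm ?ltW.
  by move: mC; rewrite /C1; lra.
have := hd s; rewrite subr0 gtr0_norm// => /(_ sd) up1.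
have := hd (- s); rewrite subr0 normrN gtr0_norm// => /(_ sd) up2.
have := hd' s; rewrite gtr0_norm// => /(_ s0 sd'); rewrite ltr_norml => /andP[l1 l2].
have := hd' (- s); rewrite normrN gtr0_norm// => /(_ s0 sd').
rewrite ltr_norml => /andP[l3 l4].
rewrite sqrrN in up2.
rewrite -(ler_pM2l s0) -[s in leLHS]gtr0_norm// -normrM ler_norml mulrBr.
apply/andP; split; lra.
Qed.

Lemma dense_touching (w : V -> R) (K d : R) (x : V) : 0 < K -> 0 < d ->
  (forall x y, `|w x - w y| <= K * `|x - y|) ->
  (* The value of [k] makes [k (d / 2) = K]: beyond distance [d / 2] the penalty outweighs the
     Lipschitz variation of [w]. *)
  exists z p k, [/\ `|z - x| < d, 0 <= k &
    forall y, w y <= w z + dot p (y - z) + k * dot (y - z) (y - z)].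
Proof.
move=> K0 d0 wK; pose k := 2 * K / d.
have k0 : 0 < k by rewrite divr_gt0// mulr_gt0.
pose f z := k * dot (z - x) (z - x) - w z.
have cf : continuous f.
  apply: subr_cont; last exact: lipschitz_continuous K0 wK.
  apply: mulr_cont; first exact: cst_cont.
  by apply: dot_continuous; apply: subr_cont; try exact: cst_cont;
    move=> z; exact: cvg_id.
have kd : k * d = 2 * K by rewrite /k divfK ?gt_eqF.
have far z : d / 2 < `|z - x| -> f x < f z.
  move=> zx; rewrite /f subrr dot0l mulr0 sub0r.
  have := wK z x; rewrite ler_norml => /andP[_].
  have := ler_wpM2l (ltW k0) (norm_dotxx (z - x)).
  have : d / 2 * `|z - x| < `|z - x| ^+ 2.
    by rewrite expr2 ltr_pM2r// (lt_trans _ zx)// divr_gt0.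
  rewrite -(ltr_pM2l k0).
  have -> : k * (d / 2 * `|z - x|) = K * `|z - x|.
    by rewrite mulrA (_ : k * (d / 2) = K)// mulrA kd; field.
  lra.
have [z hz] := continuous_attains_min cf far.
exists z, (2 * k *: (z - x)), k; split; last 2 first.
- exact: ltW.
- move=> y; have := hz y; rewrite /f.
  have -> : y - x = (z - x) + (y - z) by apply/rowP => i; rewrite !mxE; ring.
  by rewrite dotxx_sqrD dotZl; lra.
rewrite ltNge; apply/negP => dz; have := hz x; rewrite leNgt far//.
by apply: lt_le_trans dz; rewrite ltr_pdivrMr// mulr_natr mulr2n ltrDl.
Qed.

Variables (H : V -> R) (DH DL : V -> V).
Hypothesis P : convex_pair H DH DL.
Local Notation L := (legendre H DL).
Variables (T : R) (uT : V -> R).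
Hypotheses (T0 : 0 < T) (uT_lip : lipschitz uT).

(** [Q] stands for the inverse Hessian of [H]. The slack [e] admits both the exact expansion of a
    quadratic [L] and a mere Peano expansion in dimension one. *)
Lemma reachable_touched_above (Q : V -> 'M[R]_n.+1) (phi : V -> R) (x : V) :
  (forall q (e : R), 0 < e -> exists2 d : R, 0 < d &
    forall h, `|h| < d -> L (q + h) <= L q + dot (DL q) h
      + (dot (h *m Q (DL q)) h + e * dot h h) / 2) ->
  initial_data H T uT !=set0 ->
  twice_differentiable phi -> local_min (uT \- phi) x ->
  forall v, dot (v *m hessian phi x) v <=
    T^-1 * dot (v *m Q (gradient phi x)) v.
Proof.
move=> HQ [u0 [u0_lip]]; rewrite (forward_hopf_lax P u0_lip T0) => uTE phi2 lmin v.
have [K K0 u0K] := (lipschitzP u0).1 u0_lip.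
have [y [xy ley]] := hopf_laxP P K0 u0K x T0.
have hl z : uT z <= u0 y + T * L (T^-1 *: (z - y)).
  by rewrite -uTE; exact: (hopf_lax_le P K0 u0K z y T0).
have hx : uT x = u0 y + T * L (T^-1 *: (x - y)) by rewrite -uTE xy.
set q := T^-1 *: (x - y) in hx.
have touch w e : 0 < e -> \forall s \near (0 : R),
    phi (x + s *: w) <= phi x + s * dot (DL q) w
      + T^-1 * (dot (w *m Q (DL q)) w + e * dot w w) / 2 * s ^+ 2.
  move=> e0; have [d d0 hd] := HQ q e e0.
  move: lmin => /nearP[d' d'0 hd'].
  have w1 : 0 < 1 + `|w| by rewrite ltr_pwDl.
  apply/nearP; exists (Num.min (d * T) d' / (1 + `|w|)).
    by rewrite divr_gt0// lt_min d'0 mulr_gt0.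
  move=> s; rewrite subr0 ltr_pdivlMr// lt_min => /andP[sd sd'].
  have sw : `|s| * `|w| <= `|s| * (1 + `|w|) by rewrite ler_wpM2l// lerDr.
  have /hd' : `|x + s *: w - x| < d'.
    by rewrite addrAC subrr add0r normrZ (le_lt_trans sw).
  have := hl (x + s *: w).
  have -> : T^-1 *: (x + s *: w - y) = q + (s / T) *: w.
    by rewrite /q; apply/rowP => i; rewrite !mxE; field; rewrite gt_eqF.
  have /hd : `|(s / T) *: w| < d.
    rewrite normrZ normrM [`|T^-1|]gtr0_norm ?invr_gt0// mulrAC ltr_pdivrMr//.
    exact: le_lt_trans sd.
  rewrite -(ler_pM2l T0) -scalemxAl !dotZl !dotZr.
  have -> : T * (L q + s / T * dot (DL q) w +
      (s / T * (s / T * dot (w *m Q (DL q)) w) + e * (s / T * (s / T * dot w w))) / 2) =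
    T * L q + s * dot (DL q) w +
      T^-1 * (dot (w *m Q (DL q)) w + e * dot w w) / 2 * s ^+ 2.
    by field; rewrite gt_eqF.
  rewrite /= hx; lra.
have [dphi _] := phi2.
(* [phi] lies below a parabola of slope [DL q] with contact at [x], which determines its gradient;
   the Hessian is then compared along each line. *)
have gradE : gradient phi x = DL q.
  apply/rowP => i; rewrite -[RHS]dot_delta mxE.
  have := is_derive_line (x := x) (v := delta_mx 0 i) (s := 0) (dphi _).
  rewrite scale0r addr0 => D0.
  apply: (is_derive_touch D0); rewrite scale0r addr0.
  exact: touch _ _ ltr01.
rewrite gradE; set M := dot (v *m Q _) v.
have le_e e : 0 < e -> dot (v *m hessian phi x) v <= T^-1 * (M + e * dot v v).
  move=> e0.
  apply: (@second_derivative_le _ (fun s => phi (x + s *: v))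
    (fun s => dot (gradient phi (x + s *: v)) v)).
  - by move=> s; rewrite -derive_gradient//; exact: is_derive_line.
  - exact: is_derive_gradient_line.
  - by rewrite scale0r addr0 gradE; exact: touch.
apply/ler_addgt0Pr => e e0.
have vv := dotxx_ge0 v; have vv1 : 0 < 1 + dot v v by rewrite ltr_pwDl.
have /le_e : 0 < T * e / (1 + dot v v) by rewrite divr_gt0// mulr_gt0.
move/le_trans; apply; rewrite mulrDr lerD2l.
have -> : T^-1 * (T * e / (1 + dot v v) * dot v v) = e * (dot v v / (1 + dot v v)).
  by field; rewrite !gt_eqF.
by rewrite ler_piMr ?ltW// ltr_pdivrMr// mul1r ltrDr.
Qed.

(** The point [z - T *: DH p] is the foot of the characteristic through [z] with momentum [p]: its
    cost has slope [p] at [z]. The hypothesis is the passage from a paraboloid touching at [z] to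
    this cost touching globally. *)
Lemma reachable_of_touching :
  (forall z p k, 0 <= k ->
     (forall x, uT x <= uT z + dot p (x - z) + k * dot (x - z) (x - z)) ->
     let y := z - T *: DH p in
     forall x, uT x - T * L (T^-1 *: (x - y)) <=
               uT z - T * L (T^-1 *: (z - y))) ->
  initial_data H T uT !=set0.
Proof.
move=> good; have [K K0 uK] := (lipschitzP uT).1 uT_lip.
have [C C0 hC] := perspective_superlinear P (ltW K0).
pose G y x := uT x - T * L (T^-1 *: (x - y)).
pose u0 y := sup (range (G y)).
have Gsup y : has_sup (range (G y)).
  split; first by exists (G y 0), 0.
  exists (uT y + T * C) => _ [x _ <-].
  have := hC T (x - y) T0; have := uK x y.
  by rewrite /G ler_norml => /andP[_]; lra.
have G_le y x : G y x <= u0 y by apply: ub_le_sup; [case: (Gsup y)|exists x].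
have u0_le y c : (forall x, G y x <= c) -> u0 y <= c.
  by move=> hc; apply: ge_sup; [case: (Gsup y)|move=> _ [x _ <-]].
have u0K x y : `|u0 x - u0 y| <= K * `|x - y|.
  have lip a b : u0 a <= u0 b + K * `|a - b|.
    apply: u0_le => x'; have := G_le b (x' + (b - a)); rewrite /G.
    have -> : x' + (b - a) - b = x' - a by apply/rowP => i; rewrite !mxE; ring.
    have := uK x' (x' + (b - a)).
    have -> : x' - (x' + (b - a)) = a - b by apply/rowP => i; rewrite !mxE; ring.
    by rewrite ler_norml => /andP[_]; lra.
  have := lip x y; have := lip y x; rewrite (distrC y x) => h1 h2.
  by rewrite ler_norml; apply/andP; split; lra.
have u0_lip : lipschitz u0 by apply/lipschitzP; exists K.
exists u0; split => //; rewrite (forward_hopf_lax P u0_lip T0).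
apply/funext => x; apply/eqP; rewrite eq_le; apply/andP; split; last first.
  have [y [-> _]] := hopf_laxP P K0 u0K x T0.
  by have := G_le y x; rewrite /G /hopf_lax_cost; lra.
apply/ler_addgt0Pr => e e0.
(* [uT] and the Hopf-Lax function are both [K]-Lipschitz, so moving from [x] to [z] costs at most
   [2 K |z - x|]. *)
have d0 : 0 < e / (2 * K) by rewrite divr_gt0// mulr_gt0.
have [z [p [k [zx k0 touch]]]] := dense_touching x K0 d0 uK.
have := good z p k k0 touch; set y := z - T *: DH p => hy.
have := hopf_lax_le P K0 u0K z y T0.
have : u0 y <= G y z by apply: u0_le.
have := hopf_lax_lipschitz P K0 u0K T x z; have := uK z x.
rewrite !ler_norml (distrC x z) => /andP[_ h1] /andP[_ h2].
move: zx; rewrite ltr_pdivlMr ?mulr_gt0// /G.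
lra.
Qed.

End reachability.

(** * Quadratic Hamiltonians *)

Section concavity.
Context {R : realType} {n : nat}.
Local Notation V := ('rV[R]_n.+1).

Lemma form_bound (S : 'M[R]_n.+1) : exists2 C : R, 0 <= C &
  forall v : V, dot (v *m S) v <= C * dot v v.
Proof.
exists (\sum_i n.+1%:R * `|row i S|).
  by apply: sumr_ge0 => i _; rewrite mulr_ge0.
move=> v; apply: le_trans (ler_wpM2l _ (norm_dotxx v)); last first.
  by apply: sumr_ge0 => i _; rewrite mulr_ge0.
rewrite mulmx_sum_row.
have -> : dot (\sum_i v 0 i *: row i S) v = \sum_i v 0 i * dot (row i S) v.
  rewrite /dot; under [RHS]eq_bigr do rewrite mulr_sumr.
  rewrite exchange_big/=; apply: eq_bigr => j _.
  rewrite summxE mulr_suml; apply: eq_bigr => i _.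
  by rewrite !mxE mulrA.
rewrite mulr_suml; apply: ler_sum => i _.
apply: le_trans (ler_norm _) _; rewrite normrM expr2 mulrA mulrC.
apply: ler_pM => //; last exact: coord_le_norm.
exact: dot_norm_le.
Qed.

Lemma eigenvalue_le_lambda_max (S : 'M[R]_n.+1) (b : R) :
  eigenvalue S b -> b <= lambda_max S.
Proof.
move=> Sb; apply: ub_le_sup => //.
have [C C0 hC] := form_bound S; exists C => c /= /eigenvalueP[v vS v0].
have vv : 0 < dot v v.
  by apply: lt_le_trans (norm_dotxx v); rewrite exprn_gt0// normr_gt0.
by have := hC v; rewrite vS dotZl ler_pM2r.
Qed.

Lemma lambda_max_le0 (S : 'M[R]_n.+1) :
  (forall v : V, dot (v *m S) v <= 0) -> lambda_max S <= 0.
Proof.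
move=> S0; rewrite /lambda_max; set E := [set a | _].
(* [S] is not known to be symmetric, as it comes from the Hessian of a test function, so it might
   have no real eigenvalue; the supremum of the empty set is 0. *)
have [->|/set0P E0] := eqVneq E set0; first by rewrite sup0.
apply: ge_sup => // c /eigenvalueP[v vS v0].
have vv : 0 < dot v v.
  by apply: lt_le_trans (norm_dotxx v); rewrite exprn_gt0// normr_gt0.
by have := S0 v; rewrite vS dotZl pmulr_lle0.
Qed.

(* If [w] is strictly below its chord between [x] and [y], then on a thin
   cylinder around the segment [w - psi] has an interior minimum, where [psi] is
   strictly convex in the direction [y - x] and very concave across it. *)
Lemma concave_of_no_convex_test (w : V -> R) :
  continuous w ->
  (forall (a : V) (S : 'M[R]_n.+1) (z : V) (b : R), S^T = S ->
     local_min (w \- qform a S) z -> eigenvalue S b -> b <= 0) ->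
  forall (x y : V) (s : R), 0 <= s <= 1 ->
    (1 - s) * w x + s * w y <= w (x + s *: (y - x)).
Proof.
move=> cw test x y s /andP[s0 s1].
rewrite leNgt; apply/negP; set mid := x + _ => below.
pose gap := (1 - s) * w x + s * w y - w mid.
have gap0 : 0 < gap by rewrite subr_gt0.
pose e := y - x; pose N := dot e e.
have e0 : e != 0.
  apply: contraTneq below => e0; rewrite -leNgt /mid -/e e0 scaler0 addr0.
  have -> : y = x by apply/eqP; rewrite -subr_eq0 -/e e0.
  by rewrite -mulrDl subrK mul1r.
have N0 : 0 < N.
  by apply: lt_le_trans (norm_dotxx e); rewrite exprn_gt0// normr_gt0.
pose sg (z : V) := dot (z - x) e / N.
pose pp (z : V) := dot (z - x) (z - x) - sg z ^+ 2 * N.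
have csub : continuous (fun z : V => z - x).
  by apply: subr_cont; [move=> z; exact: cvg_id|exact: cst_cont].
have csg : continuous sg.
  apply: mulr_cont; last exact: cst_cont.
  by apply: dot_continuous; [exact: csub|exact: cst_cont].
have cpp : continuous pp.
  apply: subr_cont; first exact: dot_continuous.
  by apply: mulr_cont; [exact: (mulr_cont csg csg)|exact: cst_cont].
have ppE z : pp z = dot (z - x - sg z *: e) (z - x - sg z *: e).
  have -> : z - x - sg z *: e = (z - x) + (- sg z) *: e by rewrite scaleNr.
  rewrite dotxx_sqrD !(dotZr _ _ e) dotZl -/N /pp /sg.
  by field; rewrite gt_eqF.
have gap2 : 0 < gap / 2 by rewrite divr_gt0.
have [dx dx0 hdx] := (continuousP w x).1 (cw x) _ gap2.
have [dy dy0 hdy] := (continuousP w y).1 (cw y) _ gap2.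
(* On the end caps of the cylinder [w] stays within [gap / 2] of its end values, short of the depth
   [3 / 4 * gap] reached inside. *)
pose rho := Num.min dx dy / 2.
have rho0 : 0 < rho by rewrite divr_gt0// lt_min dx0.
have : rho < Num.min dx dy by rewrite /rho ltr_pdivrMr// mulr_natr mulr2n ltrDl lt_min dx0.
rewrite lt_min => /andP[rdx rdy].
have pp_norm z : pp z <= rho ^+ 2 -> `|z - x - sg z *: e| <= rho.
  move=> ppz; rewrite -(ler_pXn2r (_ : (0 < 2)%N))// ?nnegrE ?(ltW rho0)//.
  by apply: le_trans (norm_dotxx _) _; rewrite -ppE.
pose K : set V := [set z | 0 <= sg z <= 1 /\ pp z <= rho ^+ 2].
have cK : compact K.
  apply: (subclosed_compact _ (@norm_ball_compact _ _ x (rho + `|e|))).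
    have -> : K = sg @^-1` [set t | 0 <= t] `&` (sg @^-1` [set t | t <= 1]
        `&` pp @^-1` [set t | t <= rho ^+ 2]).
      by apply/seteqP; split => z /=; [move=> [/andP[]]|move=> [? [? ?]]; split=> //; apply/andP].
    by apply: closedI; [|apply: closedI]; apply: preimage_closed;
      try exact: closed_ge; try exact: closed_le; move=> z _; [exact: csg|exact: csg|exact: cpp].
  move=> z [/andP[sz0 sz1] /pp_norm hz] /=.
  have := ler_normD (z - x - sg z *: e) (sg z *: e); rewrite subrK normrZ ger0_norm//.
  by have := ler_wpM2r (normr_ge0 e) sz1; lra.
have midx : mid - x = s *: e.
  by rewrite /mid /e; apply/rowP => i; rewrite !mxE; ring.
have sgmid : sg mid = s by rewrite /sg midx dotZl mulfK ?gt_eqF.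
have ppmid : pp mid = 0.
  by rewrite ppE sgmid midx subrr dot0l.
have Kmid : K mid.
  by split; rewrite ?sgmid ?s0// ppmid sqr_ge0.
have K0 : K !=set0 by exists mid.
have [zw _ hzw] := @compact_EVT_min _ _ w _ K0 cK (continuous_subspaceT cw).
(* On the lateral face, where [pp] is [rho ^+ 2], the term [D * pp] outweighs the minimum of [w] and
   the chord. *)
pose D := (`|w zw| + `|w x| + `|w y|) / rho ^+ 2.
have D0 : 0 <= D by rewrite divr_ge0 ?sqr_ge0// !addr_ge0.
(* This [c] gives [S] the eigenvalue [2 * gap / N] along [e], against [- 2 * D] across, and makes
   [qform a S] agree with [psi] up to a constant. *)
pose c := 2 * (gap + D * N) / N ^+ 2.
pose S : 'M[R]_n.+1 := c *: (e^T *m e) - (2 * D)%:M.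
have eeT (v : V) : v *m (e^T *m e) = dot v e *: e.
  rewrite mulmxA; apply/rowP => i; rewrite !mxE big_ord1 !mxE; congr (_ * _).
  by apply: eq_bigr => j _; rewrite mxE.
have vS (v : V) : v *m S = (c * dot v e) *: e - (2 * D) *: v.
  by rewrite /S mulmxBr -scalemxAr eeT mul_mx_scalar scalerA.
have ST : S^T = S.
  by rewrite /S linearB linearZ/= trmx_mul trmxK tr_scalar_mx.
pose a' : V := ((w y - w x - gap) / N) *: e.
pose a := a' - x *m S.
have aE : a + x *m S = a' by rewrite /a subrK.
pose f z := w z - qform a S z.
pose psi z := (1 - sg z) * w x + sg z * w y - gap * (sg z * (1 - sg z)) - D * pp z.
have fE z : f z = w z - psi z + f x.
  have := qformD a x (z - x) ST; rewrite subrK aE (vS (z - x)) (dotBl _ _ (z - x)).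
  rewrite !dotZl => qE.
  rewrite /f qE !(dotC e (z - x)) /psi /pp /c.
  have -> : dot (z - x) e = sg z * N by rewrite /sg mulfVK ?gt_eqF.
  by field; rewrite gt_eqF.
have cf : continuous f.
  have -> : f = fun z => w z - psi z + f x by apply/funext.
  apply: addr_cont; last exact: cst_cont.
  apply: subr_cont => //; apply: subr_cont; last first.
    by apply: mulr_cont => //; exact: cst_cont.
  have csg1 : continuous (fun z => 1 - sg z).
    by apply: subr_cont => //; exact: cst_cont.
  apply: subr_cont; last first.
    by apply: mulr_cont; [exact: cst_cont|exact: mulr_cont].
  by apply: addr_cont; apply: mulr_cont => //; exact: cst_cont.
have [z1 +  hz1] := @compact_EVT_min _ _ f _ K0 cK (continuous_subspaceT cf).
rewrite inE => -[/andP[sz0 sz1] ppz].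
(* At [mid] the difference [w - psi] is [- gap + gap * (s * (1 - s))], and [s * (1 - s)] is at most
   1/4. *)
have fz1 : w z1 - psi z1 <= - (3 / 4 * gap).
  have := hz1 mid; rewrite inE => /(_ Kmid); rewrite (fE z1) (fE mid) lerD2r {2}/psi sgmid ppmid.
  have : gap * (s * (1 - s)) <= gap * (1 / 4).
    by rewrite ler_pM2l//; have := sqr_ge0 (s - 1 / 2); lra.
  rewrite /gap; lra.
have pp0 z : 0 <= pp z by rewrite ppE dotxx_ge0.
have Dpp := mulr_ge0 D0 (pp0 z1).
have sz0' : sg z1 != 0.
  apply/eqP => sz; have := pp_norm z1 ppz; rewrite sz scale0r subr0 => h.
  have := hdx z1 (le_lt_trans h rdx); rewrite ltr_norml => /andP[+ _].
  by move: fz1; rewrite /psi sz; lra.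
have sz1' : sg z1 != 1.
  apply/eqP => sz; have := pp_norm z1 ppz; rewrite sz scale1r.
  have -> : z1 - x - e = z1 - y by apply/rowP => i; rewrite !mxE; ring.
  move=> h; have := hdy z1 (le_lt_trans h rdy); rewrite ltr_norml => /andP[+ _].
  by move: fz1; rewrite /psi sz; lra.
have ppz' : pp z1 != rho ^+ 2.
  apply/eqP => ppE1; have : w zw <= w z1 by apply: hzw; rewrite inE; split=> //; apply/andP.
  move: fz1; rewrite /psi ppE1 /D divfK ?expf_neq0 ?gt_eqF//.
  have h0 : 0 <= sg z1 * (1 - sg z1) by rewrite mulr_ge0// subr_ge0.
  have := mulr_ge0 (ltW gap0) h0.
  have := ler_norm (- w zw); rewrite normrN.
  have s1' : 0 <= 1 - sg z1 by rewrite subr_ge0.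
  have := ler_wpM2l s1' (ler_norm (w x)); have := ler_wpM2l sz0 (ler_norm (w y)).
  have := mulr_ge0 sz0 (normr_ge0 (w x)); have := mulr_ge0 s1' (normr_ge0 (w y)).
  lra.
have lmin : local_min (w \- qform a S) z1.
  have sg0 : 0 < sg z1 by rewrite lt_neqAle eq_sym sz0'.
  have sg1 : sg z1 < 1 by rewrite lt_neqAle sz1'.
  have ppr : pp z1 < rho ^+ 2 by rewrite lt_neqAle ppz'.
  have sg1' : 0 < 1 - sg z1 by rewrite subr_gt0.
  have ppr' : 0 < rho ^+ 2 - pp z1 by rewrite subr_gt0.
  have [d1 d10 h1] := (continuousP sg z1).1 (csg z1) _ sg0.
  have [d2 d20 h2] := (continuousP sg z1).1 (csg z1) _ sg1'.
  have [d3 d30 h3] := (continuousP pp z1).1 (cpp z1) _ ppr'.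
  apply/nearP; exists (Num.min d1 (Num.min d2 d3)); first by rewrite !lt_min d10 d20.
  move=> z; rewrite !lt_min => /and3P[/h1 + /h2 + /h3].
  rewrite !ltr_norml => /andP[l1 _] /andP[_ l2] /andP[_ l3].
  apply: hz1; rewrite inE /K /=; split; last by move: l3; clear; lra.
  by move: l1 l2; clear => *; apply/andP; split; lra.
have ev : eigenvalue S (2 * gap / N).
  apply/eigenvalueP; exists e => //.
  rewrite vS -/N -scalerBl; congr (_ *: _).
  by rewrite /c; field; rewrite gt_eqF.
have := test a S z1 _ ST lmin ev.
by rewrite leNgt divr_gt0// mulr_gt0.
Qed.

End concavity.

Section quadratic_hamiltonian.
Context {R : realType} {n : nat}.
Local Notation V := ('rV[R]_n.+1).
Variable A : 'M[R]_n.+1.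
Hypotheses (AT : A^T = A) (A0 : forall p : V, p != 0 -> 0 < quad A p).
Local Notation B := (invmx A).
Local Notation H := (fun p : V => quad A p / 2).
Local Notation DH := (mulmxr A : V -> V).
Local Notation DL := (mulmxr B : V -> V).

Lemma quadE (p : V) : quad A p = dot (p *m A) p.
Proof. by rewrite /quad mxE; apply: eq_bigr => i _; rewrite [p^T _ _]mxE. Qed.

Lemma posdef_unitmx : A \in unitmx.
Proof.
rewrite -row_free_unit -kermx_eq0; apply/rowV0P => v /sub_kermxP vA.
apply/eqP; apply/negPn/negP => /A0.
by rewrite quadE vA dot0l ltxx.
Qed.

Lemma invmx_sym : B^T = B.
Proof. by rewrite trmx_inv AT. Qed.

Lemma legendre_quad (q : V) : legendre H DL q = qform 0 B q.
Proof.
rewrite /legendre /qform dot0l add0r quadE /= mulmxKV ?posdef_unitmx//.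
by rewrite (dotC (q *m B)); field.
Qed.

Lemma legendre_quadD (q h : V) : legendre H DL (q + h) =
  legendre H DL q + dot (DL q) h + dot (h *m B) h / 2.
Proof. by rewrite !legendre_quad addrC (qformD _ _ _ invmx_sym) add0r. Qed.

Lemma quad_convex_pair : convex_pair H DH DL.
Proof.
split=> [q|p|p p'|q] /=.
- by rewrite mulmxKV ?posdef_unitmx.
- by rewrite mulmxK ?posdef_unitmx.
- have := qformD 0 p (p' - p) AT; rewrite subrK /qform !dot0l !add0r !quadE => ->.
  rewrite lerDl divr_ge0// -quadE.
  by have [->|/A0/ltW//] := eqVneq (p' - p) 0; rewrite quadE dot0r.
have [C C0 hC] := form_bound B.
exists (C / 2), 1; split; rewrite ?divr_ge0// => h _.
by rewrite legendre_quadD lerD2l mulrAC ler_pM2r.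
Qed.

Variables (T : R) (uT : V -> R).
Hypotheses (T0 : 0 < T) (uT_lip : lipschitz uT).

Lemma quad_semiconcave :
  viscosity_le0 (fun _ X => lambda_max (X - T^-1 *: B)) uT ->
  forall (x y : V) (s : R), 0 <= s <= 1 ->
    (1 - s) * (uT x - qform 0 (T^-1 *: B) x)
      + s * (uT y - qform 0 (T^-1 *: B) y) <=
    uT (x + s *: (y - x)) - qform 0 (T^-1 *: B) (x + s *: (y - x)).
Proof.
move=> visc; have [K K0 uK] := (lipschitzP uT).1 uT_lip.
have TBT : (T^-1 *: B)^T = T^-1 *: B by rewrite linearZ/= invmx_sym.
apply: concave_of_no_convex_test.
  apply: subr_cont; first exact: lipschitz_continuous K0 uK.
  move=> x; apply: (@differentiable_continuous _ V R).
  by have [dq _] := qform_twice_differentiable (0 : V) TBT.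
move=> a S z b ST lmin Sb.
have SBT : (S + T^-1 *: B)^T = S + T^-1 *: B by rewrite linearD/= ST TBT.
have := visc _ (qform_twice_differentiable a SBT) z.
rewrite (hessian_qform _ _ SBT) addrK => le0.
apply: le_trans (eigenvalue_le_lambda_max Sb) (le0 _).
move: lmin => /nearP[d d0 hd]; apply/nearP; exists d => // y /hd.
rewrite /= /qform !mulmxDr !dotDl !dot0l; lra.
Qed.

Lemma quad_reachableP :
  initial_data H T uT !=set0 <->
  viscosity_le0 (fun _ X => lambda_max (X - T^-1 *: B)) uT.
Proof.
have P := quad_convex_pair; split=> [reach phi phi2 x lmin|visc].
  apply: lambda_max_le0 => v.
  have /= := @reachable_touched_above _ _ _ _ _ P T uT T0 (fun=> B) phi x _ reach phi2 lmin v.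
  rewrite mulmxBr dotBl -scalemxAr dotZl subr_le0; apply.
  move=> q e e0; exists 1 => // h _; rewrite legendre_quadD lerD2l mulrDl lerDl.
  by rewrite divr_ge0// mulr_ge0 ?dotxx_ge0// ltW.
apply: (reachable_of_touching P T0 uT_lip) => z p k k0 touch y x.
pose h := x - z; pose w x := uT x - qform 0 (T^-1 *: B) x.
have TBT : (T^-1 *: B)^T = T^-1 *: B by rewrite linearZ/= invmx_sym.
have scal (r : R) (u v : V) : dot (u *m (r *: B)) v = r * dot (u *m B) v.
  by rewrite -scalemxAr dotZl.
have Lz : T^-1 *: (z - y) = p *m A.
  by rewrite /y /= opprB addrC subrK scalerA mulVf ?gt_eqF// scale1r.
have Lx : T^-1 *: (x - y) = p *m A + T^-1 *: h.
  by rewrite -Lz -scalerDr /h; congr (_ *: _); apply/rowP => i; rewrite !mxE; ring.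
rewrite Lz Lx legendre_quadD /= mulmxK ?posdef_unitmx//.
rewrite -scalemxAl !dotZl !dotZr.
suff : uT x <= uT z + dot p h + T^-1 * dot (h *m B) h / 2.
  move=> up; rewrite !mulrDr.
  have -> : T * (T^-1 * dot p h) = dot p h by field; rewrite gt_eqF.
  have -> : T * (T^-1 * (T^-1 * dot (h *m B) h) / 2) = T^-1 * dot (h *m B) h / 2.
    by field; rewrite gt_eqF.
  lra.
pose Q := T^-1 * dot (h *m B) h / 2; pose d := dot p h.
rewrite -/Q -/d.
(* Concavity bounds the increment over the whole segment by the increment up to [s] divided by [s];
   the quadratic errors keep a factor [s], which tends to 0. *)
have line (s : R) : 0 < s -> s <= 1 -> uT x - uT z - d - Q <= s * (k * dot h h - Q).
  move=> s0 s1.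
  have sI : 0 <= s <= 1 by rewrite s1 ltW.
  have := quad_semiconcave visc z x sI; rewrite -/h.
  have qf (r : R) : qform 0 (T^-1 *: B) (z + r *: h) =
     qform 0 (T^-1 *: B) z + r * (T^-1 * dot (z *m B) h) + r ^+ 2 * Q.
    rewrite addrC (qformD _ _ _ TBT) add0r !scal dotZr -scalemxAl dotZl dotZr /Q.
    by field; rewrite gt_eqF.
  have := qf 1; rewrite scale1r {1}/h addrC subrK => ->.
  rewrite (qf s); have := touch (z + s *: h).
  have -> : z + s *: h - z = s *: h by rewrite addrAC subrr add0r.
  rewrite dotZl !dotZr -/d => t1 t2.
  rewrite -(ler_pM2l s0); move: t1 t2.
  move: (dot (z *m B) h) (qform _ _ _) (dot h h) => X1 X2 X3; nra.
apply/ler_addgt0Pr => e e0.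
pose M := `|k * dot h h - Q|.
have M1 : 0 < 1 + M by rewrite /M ltr_pwDl.
pose s := Num.min 1 (e / (1 + M)).
have s0 : 0 < s by rewrite lt_min ltr01 divr_gt0.
have s1 : s <= 1 by rewrite ge_min lexx.
have : s * (1 + M) <= e by rewrite -ler_pdivlMr// ge_min lexx orbT.
have := line s s0 s1; have := ler_wpM2l (ltW s0) (ler_norm (k * dot h h - Q)).
rewrite -/M; lra.
Qed.

End quadratic_hamiltonian.

(** * Strictly convex Hamiltonians in dimension one *)

Section strictly_convex_hamiltonian.
Context {R : realType}.
Local Notation V := ('rV[R]_1).
Local Notation e1 := (delta_mx 0 0 : V).

Lemma row1E (x : V) : x = x 0 0 *: e1.
Proof. by apply/rowP => i; rewrite !mxE !ord1/= mulr1. Qed.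

Lemma dot1E (x y : V) : dot x y = x 0 0 * y 0 0.
Proof. by rewrite /dot big_ord1. Qed.

Lemma norm1E (x : V) : `|x| = `|x 0 0|.
Proof. by have [i ->] := normr_le_coord x; rewrite ord1. Qed.

Variable H : V -> R.
Hypotheses (H2 : Ck 2 H) (Hpos : forall p, 0 < hessian H p 0 0).
Hypothesis Hsup : superlinear H.

Local Notation h := (fun s : R => H (s *: e1)).
Local Notation h1 := (fun s : R => 'D_e1 H (s *: e1)).
Local Notation h2 := (fun s : R => hessian H (s *: e1) 0 0).

Lemma is_derive_h (s : R) : is_derive s 1 h (h1 s).
Proof.
have [dH _] := H2; have := is_derive_line (x := 0) (v := e1) (s := s) (dH _).
by under eq_fun do rewrite add0r; rewrite add0r.
Qed.

Lemma is_derive_h1 (s : R) : is_derive s 1 h1 (h2 s).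
Proof.
have [_ /(_ e1) [dH1 _]] := H2.
have := is_derive_line (x := 0) (v := e1) (s := s) (dH1 _).
by under eq_fun do rewrite add0r; rewrite add0r mxE.
Qed.

Lemma h1_lt (s t : R) : s < t -> h1 s < h1 t.
Proof.
move=> st; have [th [_ E]] := MVT_between s t is_derive_h1.
by rewrite -subr_gt0 E mulr_gt0// subr_gt0.
Qed.

Lemma h1_le (s t : R) : s <= t -> h1 s <= h1 t.
Proof. by rewrite le_eqVlt => /predU1P[->//|/h1_lt/ltW]. Qed.

Lemma h_convex (s t : R) : h s + h1 s * (t - s) <= h t.
Proof.
have [th [/andP[th0 th1] E]] := MVT_between s t is_derive_h.
suff : h1 s * (t - s) <= h1 (s + th * (t - s)) * (t - s) by lra.
have [ts|ts] := leP 0 (t - s).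
  by rewrite ler_wpM2r// h1_le// lerDl mulr_ge0// ltW.
rewrite ler_nM2r// h1_le// gerDl mulr_ge0_le0// ltW//.
Qed.

Lemma h1_surjective (q : R) : exists s, h1 s = q.
Proof.
(* With [h] above [M * s] at both [s] and [- s], convexity against the value at 0 puts [q] between
   the slopes there. Taking [s >= 1] lets one [H 0] in [M] pay for the value at 0. *)
pose M : R := `|q| + `|H (0 *: e1)| + 1.
have [r hr] := Hsup M; pose s : R := `|r| + 1.
have s1 : 1 <= s by rewrite /s lerDr.
have s0 : 0 < s by rewrite (lt_le_trans ltr01).
have rs : r < s by rewrite (le_lt_trans (ler_norm _))// /s ltrDl.
have e11 : `|e1| = 1 by rewrite norm1E mxE normr1.
have big (t : R) : `|t| = s -> M * s < h t.
  move=> ts; have := hr (t *: e1); rewrite normrZ e11 mulr1 ts => /(_ rs).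
  by rewrite ltr_pdivlMr.
have h0s : `|H (0 *: e1)| <= `|H (0 *: e1)| * s by rewrite ler_peMr.
have hiq : q <= h1 s.
  have /= := h_convex s 0; have /= := big s (gtr0_norm s0).
  have := ler_wpM2r (ltW s0) (ler_norm q); have := ler_norm (H (0 *: e1)).
  by rewrite /= -[_ <= 'D_e1 H _](ler_pM2r s0) /M => *; lra.
have loq : h1 (- s) <= q.
  have /= := h_convex (- s) 0.
  have := big (- s); rewrite normrN gtr0_norm// => /(_ erefl) /=.
  have := ler_wpM2r (ltW s0) (ler_norm (- q)); have := ler_norm (H (0 *: e1)).
  by rewrite /= !normrN -['D_e1 H _ <= _](ler_pM2r s0) /M => *; lra.
have [|||c _ cq] := @IVT _ h1 (- s) s q.
- by rewrite -subr_ge0 opprK addr_ge0// ltW.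
- apply: continuous_subspaceT => x.
  apply: (@differentiable_continuous _ R R); apply/derivable1_diffP.
  by have [] := is_derive_h1 x.
- by rewrite ge_min loq le_max hiq orbT.
by exists c.
Qed.


Lemma H_taylor (p : V) (e : R) : 0 < e -> exists2 d : R, 0 < d &
  forall r : R, `|r| < d ->
    `|H (p + r *: e1) - H p - r * 'D_e1 H p - hessian H p 0 0 / 2 * r ^+ 2|
      <= e * r ^+ 2.
Proof.
move=> e0; have [dH /(_ e1)[dH1 _]] := H2.
pose g (r : R) := H (p + r *: e1); pose dg (r : R) := 'D_e1 H (p + r *: e1).
have g'E (s : R) : is_derive s 1 g (dg s) by exact: is_derive_line.
have dg'E : is_derive (0 : R) 1 dg (hessian H p 0 0).
  have := is_derive_line (x := p) (v := e1) (s := 0) (dH1 _).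
  by rewrite mxE scale0r addr0.
have [d d0 hd] := taylor2 g'E dg'E e0; exists d => // r /hd.
by rewrite /g /dg scale0r addr0.
Qed.

Variable g : R -> R.
Hypothesis gK : forall q, h1 (g q) = q.
Local Notation DL := (fun q : V => g (q 0 0) *: e1).
Local Notation DH := (fun p : V => 'D_e1 H p *: e1).
Local Notation L := (legendre H DL).

Lemma g_continuous (q e : R) : 0 < e -> exists2 d : R, 0 < d &
  forall b, `|b| < d -> `|g (q + b) - g q| < e.
Proof.
move=> e0; pose d1 := h1 (g q + e) - q; pose d2 := q - h1 (g q - e).
have d10 : 0 < d1 by rewrite subr_gt0 -{1}(gK q) h1_lt// ltrDl.
have d20 : 0 < d2 by rewrite subr_gt0 -{2}(gK q) h1_lt// gtrBl.
exists (Num.min d1 d2); first by rewrite lt_min d10.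
move=> b; rewrite lt_min !ltr_norml => /andP[/andP[_ b1] /andP[b2 _]].
apply/andP; split; rewrite ltNge; apply/negP => ge.
  have /h1_le : g (q + b) <= g q - e by lra.
  by rewrite gK; move: b2; rewrite /d2; lra.
have /h1_le : g q + e <= g (q + b) by lra.
by rewrite gK; move: b1; rewrite /d1; lra.
Qed.

(** The maximiser moves by [r] when [q] moves by [b], and the gain [b r - (c / 2 - e') r^2] is at
    most its maximum over all [r]. Continuity of [g] keeps [r] in the range of the expansion of
    [H]. *)
Lemma legendre_le_second (q : V) (e : R) : 0 < e -> exists2 d : R, 0 < d &
  forall v, `|v| < d -> L (q + v) <= L q + dot (DL q) v
    + (dot (v *m ((hessian H (DL q) 0 0)^-1)%:M) v + e * dot v v) / 2.
Proof.
move=> e0 /=; set p := g _ *: _; set c := hessian _ _ _ _.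
have c0 : 0 < c by exact: Hpos.
(* The first bound keeps [c - 2 * e'] above [c / 2]; the second brings its inverse below
   [c^-1 + e]. *)
pose e' := Num.min (c / 4) (e * c ^+ 2 / 4).
have e'0 : 0 < e' by rewrite lt_min !divr_gt0// mulr_gt0// exprn_gt0.
have [d1 d10 hd1] := H_taylor p e'0.
have [d d0 hd] := g_continuous (q 0 0) d10.
exists d => // v; rewrite norm1E => /hd.
pose b : R := v 0 0; pose r : R := g (q 0 0 + b) - g (q 0 0).
rewrite -/b -/r => /hd1.
have -> : p + r *: e1 = g (q 0 0 + b) *: e1 by rewrite /p -scalerDl /r subrKC.
rewrite ler_norml => /andP[lo _].
have Dp : 'D_e1 H p = q 0 0 by exact: gK.
rewrite mul_mx_scalar dotZl /legendre !dot1E !mxE !eqxx !mulr1 -/b -/p.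
have -> : g (q 0 0 + b) = g (q 0 0) + r by rewrite /r subrKC.
rewrite /= in lo *; move: lo; rewrite Dp -/c.
have -> : g (q 0 0 + b) = g (q 0 0) + r by rewrite /r subrKC.
move=> lo.
have e'1 : e' <= c / 4 by rewrite ge_min lexx.
have e'2 : e' <= e * c ^+ 2 / 4 by rewrite ge_min lexx orbT.
have key : b * r - (c / 2 - e') * r ^+ 2 <= (c^-1 + e) / 2 * b ^+ 2.
  pose k := c - 2 * e'; have k0 : 0 < k by rewrite /k; lra.
  have kc : k^-1 <= c^-1 + e.
    have c1 : c * c^-1 = 1 by rewrite divff// gt_eqF.
    have kc2 : c / 2 <= k by rewrite /k; lra.
    rewrite -[leLHS]mul1r ler_pdivrMr// mulrDl.
    have -> : c^-1 * k = 1 - 2 * e' / c by rewrite /k; field; rewrite gt_eqF.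
    have : 2 * e' / c <= e * c / 2.
      rewrite ler_pdivrMr//; have -> : e * c / 2 * c = 2 * (e * c ^+ 2 / 4) by field.
      by rewrite ler_pM2l.
    have := ler_wpM2l (ltW e0) kc2; lra.
  have : b * r - (c / 2 - e') * r ^+ 2 <= k^-1 / 2 * b ^+ 2.
    rewrite -subr_ge0.
    have -> : k^-1 / 2 * b ^+ 2 - (b * r - (c / 2 - e') * r ^+ 2) =
      (b - k * r) ^+ 2 / (2 * k) by rewrite /k; field; rewrite gt_eqF.
    by rewrite divr_ge0 ?sqr_ge0// mulr_ge0// ltW.
  have : k^-1 / 2 * b ^+ 2 <= (c^-1 + e) / 2 * b ^+ 2.
    by rewrite ler_wpM2r ?sqr_ge0// ler_pM2r.
  lra.
have -> : c^-1 * b * b + e * (b * b) = (c^-1 + e) * b ^+ 2 by ring.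
lra.
Qed.

Lemma strictly_convex_pair : convex_pair H DH DL.
Proof.
split=> [q|p|p p'|q] /=.
- by rewrite [RHS]row1E gK.
- rewrite [RHS]row1E; congr (_ *: _); rewrite !mxE eqxx mulr1.
  apply/eqP; rewrite eq_le !leNgt; apply/andP; split; apply/negP => /h1_lt.
    by rewrite gK -row1E ltxx.
  by rewrite gK -row1E ltxx.
- have := h_convex (p 0 0) (p' 0 0); rewrite -!row1E => /=.
  by rewrite dot1E !mxE eqxx mulr1.
have [d d0 hd] := legendre_le_second q ltr01.
exists (((hessian H (g (q 0 0) *: e1) 0 0)^-1 + 1) / 2), d; split=> //.
  by rewrite divr_ge0// addr_ge0// invr_ge0 ltW.
move=> v /hd /=; rewrite mul_mx_scalar (dotZl _ v) mul1r; lra.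
Qed.

Lemma legendre_ge_second (q : V) (a : R) :
  0 < a -> a * hessian H (DL q) 0 0 < 1 -> exists2 d : R, 0 < d &
  forall v, `|v| < d -> L q + dot (DL q) v + a / 2 * dot v v <= L (q + v).
Proof.
move=> a0 /=; set p := g _ *: _; set c := hessian _ _ _ _ => ac.
(* The loss for which the trial momentum [p + a v] in the Legendre inequality yields exactly
   [a / 2 * v^2]. *)
pose e := (1 - a * c) / (2 * a).
have e0 : 0 < e by rewrite divr_gt0 ?subr_gt0// mulr_gt0.
have [d1 d10 hd1] := H_taylor p e0.
exists (d1 / a); first by rewrite divr_gt0.
move=> v; rewrite norm1E ltr_pdivlMr// => vd.
pose r := a * v 0 0.
have /hd1 : `|r| < d1 by rewrite /r normrM gtr0_norm// mulrC.
rewrite ler_norml => /andP[_ up].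
have := legendre_ge strictly_convex_pair (q + v) (p + r *: e1).
have Dp : 'D_e1 H p = q 0 0 by exact: gK.
move: up; rewrite Dp -/c => up low; apply: le_trans low.
rewrite /legendre -/p !dot1E !mxE eqxx /= !mulr1.
move: up; set Hp := H (p + _) => up.
have -> : a / 2 * (v 0 0 * v 0 0) = v 0 0 * r - (c / 2 + e) * r ^+ 2.
  by rewrite /r /e; field; rewrite gt_eqF.
lra.
Qed.

End strictly_convex_hamiltonian.

(** * From local to global touching in dimension one *)

Section one_dimensional_reachability.
Context {R : realType}.
Local Notation V := ('rV[R]_1).
Local Notation e1 := (delta_mx 0 0 : V).
Variables (H : V -> R) (DH DL : V -> V).
Hypothesis P : convex_pair H DH DL.
Local Notation L := (legendre H DL).
Hypothesis Hpos : forall p, 0 < hessian H p 0 0.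
Hypothesis L2 : forall (q : V) (a : R), 0 < a -> a * hessian H (DL q) 0 0 < 1 ->
  exists2 d : R, 0 < d &
  forall v, `|v| < d -> L q + dot (DL q) v + a / 2 * dot v v <= L (q + v).
Variables (T : R) (uT : V -> R).
Hypotheses (T0 : 0 < T) (uT_lip : lipschitz uT).
Hypothesis visc :
  viscosity_le0 (fun p X => X 0 0 - (T * hessian H p 0 0)^-1) uT.

Local Notation cost t y := (fun x : V => t * L (t^-1 *: (x - y))).

(* The Hessian of [cost t y] is [(t H'')^-1 > (T H'')^-1]. *)
Lemma no_local_min (t : R) (y x : V) : 0 < t < T -> ~ local_min (uT \- cost t y) x.
Proof.
move=> /andP[t0 tT] /nearP[d d0 lmin].
set q := t^-1 *: (x - y); pose p := DL q; pose c := hessian H p 0 0.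
have c0 : 0 < c by exact: Hpos.
(* The midpoint choice puts [a * c] strictly between [t / T] and 1: below 1 for the expansion of
   [L], above [t / T] to violate the viscosity inequality. *)
pose a := (1 + t / T) / (2 * c).
have tT1 : t / T < 1 by rewrite ltr_pdivrMr// mul1r.
have tT0 : 0 < t / T by rewrite divr_gt0.
have a0 : 0 < a by rewrite divr_gt0// ?mulr_gt0// addr_gt0.
have ac : a * c = (1 + t / T) / 2 by rewrite /a; field; rewrite !gt_eqF.
have ac1 : a * c < 1 by rewrite ac ltr_pdivrMr//; lra.
have [d1 d10 hd1] := L2 a0 ac1.
pose S : 'M[R]_1 := (a / t)%:M.
have ST : S^T = S by rewrite tr_scalar_mx.
pose b := p - x *m S; have bx : b + x *m S = p by rewrite subrK.
have SE (v : V) : v *m S = (a / t) *: v by exact: mul_mx_scalar.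
have := visc (qform_twice_differentiable b ST) (x := x).
rewrite (hessian_qform _ _ ST) (gradient_qform _ _ ST) subrK -/c.
have lm : local_min (uT \- qform b S) x.
  apply/nearP; exists (Num.min d (d1 * t)); first by rewrite lt_min d0 mulr_gt0.
  move=> z; rewrite lt_min => /andP[/lmin zd zd1].
  have /hd1 : `|t^-1 *: (z - x)| < d1.
    by rewrite normrZ gtr0_norm ?invr_gt0// mulrC ltr_pdivrMr.
  have -> : q + t^-1 *: (z - x) = t^-1 *: (z - y).
    by rewrite /q -scalerDr; congr (_ *: _); apply/rowP => i; rewrite !mxE; ring.
  rewrite -(ler_pM2l t0) (dotZr _ (DL q)) dotZl dotZr.
  have := qformD b x (z - x) ST; rewrite subrK bx (SE (z - x)) (dotZl _ (z - x)).
  move: zd; rewrite /= -/q -/p => lmin1 -> lo.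
  have E : t * (L q + t^-1 * dot p (z - x) + a / 2 * (t^-1 * (t^-1 * dot (z - x) (z - x))))
    = t * L q + dot p (z - x) + a / t * dot (z - x) (z - x) / 2.
    by field; rewrite gt_eqF.
  by move: lo; rewrite E; lra.
move/(_ lm); rewrite /S mxE eqxx mulr1n subr_le0 => h.
have : a / t * (t * c) <= (T * c)^-1 * (t * c) by rewrite ler_pM2r// mulr_gt0.
have -> : a / t * (t * c) = a * c by field; rewrite gt_eqF.
have -> : (T * c)^-1 * (t * c) = t / T by field; rewrite !gt_eqF.
rewrite ac; lra.
Qed.

Lemma cost_continuous_time (v : V) (e : R) : 0 < e ->
  exists2 d : R, 0 < d & forall t, 0 < t -> T - d < t -> t <= T ->
    `|t * L (t^-1 *: v) - T * L (T^-1 *: v)| < e.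
Proof.
move=> e0; pose ta (t : R) := Num.max (T / 2) t.
have T2 : 0 < T / 2 by rewrite divr_gt0.
have cta : continuous ta.
  move=> t; apply/continuousP => r r0; exists r => // s st.
  by apply: le_lt_trans st; exact: dist_max_le.
have cF : continuous (fun t => ta t * L ((ta t)^-1 *: v)).
  apply: mulr_cont => //; apply: comp_cont (legendre_continuous P).
  apply: scaler_cont; last exact: cst_cont.
  by apply: invr_cont => // t; rewrite gt_eqF// lt_max T2.
have [d d0 hd] := (continuousP _ T).1 (cF T) e e0.
exists (Num.min d (T / 2)); first by rewrite lt_min d0.
move=> t t0 td tT.
have : Num.min d (T / 2) <= d by rewrite ge_min lexx.
have : Num.min d (T / 2) <= T / 2 by rewrite ge_min lexx orbT.
move=> m1 m2.
have := hd t; rewrite /ta !max_r; [|lra|lra].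
by apply; rewrite distrC ger0_norm; lra.
Qed.

(** A strict dip of [w] between [a] and [b] survives when the horizon is lowered slightly below [T].
    The minimum over the segment is then interior, which [no_local_min] forbids. *)
Lemma cost_quasiconcave (y a b : V) (s : R) : 0 < s < 1 ->
  let w x := uT x - T * L (T^-1 *: (x - y)) in
  w (a + s *: (b - a)) < w a -> w (a + s *: (b - a)) < w b -> False.
Proof.
move=> /andP[s0 s1] w wa wb.
have [K K0 uK] := (lipschitzP uT).1 uT_lip.
set m := a + s *: (b - a) in wa wb.
pose gap := Num.min (w a - w m) (w b - w m).
have gap0 : 0 < gap by rewrite lt_min !subr_gt0 wa.
have gapa : gap <= w a - w m by rewrite ge_min lexx.
have gapb : gap <= w b - w m by rewrite ge_min lexx orbT.
have gap2 : 0 < gap / 2 by rewrite divr_gt0.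
have [da da0 hda] := cost_continuous_time (a - y) gap2.
have [db db0 hdb] := cost_continuous_time (b - y) gap2.
have [dm dm0 hdm] := cost_continuous_time (m - y) gap2.
pose d := Num.min (Num.min da db) (Num.min dm T).
have d0 : 0 < d by rewrite !lt_min da0 db0 dm0.
have : d <= d by []; rewrite {2}/d !le_min => /andP[/andP[dda ddb] /andP[ddm dT]].
pose t := T - d / 2.
have t0 : 0 < t by rewrite /t; lra.
have tT : t < T by rewrite /t; lra.
have {}hda : `|t * L (t^-1 *: (a - y)) - T * L (T^-1 *: (a - y))| < gap / 2.
  by apply: hda; rewrite ?ltW//; rewrite /t; lra.
have {}hdb : `|t * L (t^-1 *: (b - y)) - T * L (T^-1 *: (b - y))| < gap / 2.
  by apply: hdb; rewrite ?ltW//; rewrite /t; lra.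
have {}hdm : `|t * L (t^-1 *: (m - y)) - T * L (T^-1 *: (m - y))| < gap / 2.
  by apply: hdm; rewrite ?ltW//; rewrite /t; lra.
pose wt x := uT x - t * L (t^-1 *: (x - y)).
have wtc : continuous wt.
  apply: subr_cont; first exact: lipschitz_continuous K0 uK.
  apply: mulr_cont; first exact: cst_cont.
  apply: comp_cont (legendre_continuous P).
  apply: scaler_cont; first exact: cst_cont.
  by apply: subr_cont; [move=> x; exact: cvg_id|exact: cst_cont].
move: hda hdb hdm; rewrite !ltr_norml => /andP[_ hda] /andP[_ hdb] /andP[hdm _].
have wta : wt m < wt a by move: gapa; rewrite /wt /w; lra.
have wtb : wt m < wt b by move: gapb; rewrite /wt /w; lra.
pose G (r : R) := wt (a + r *: (b - a)).
have cG : continuous G.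
  apply: comp_cont wtc; apply: addr_cont; first exact: cst_cont.
  by apply: scaler_cont; [move=> r; exact: cvg_id|exact: cst_cont].
have [r1 r1I hr1] := @EVT_min _ G 0 1 ler01 (continuous_subspaceT cG).
have Gs : G r1 <= wt m by apply: hr1; rewrite in_itv/= !ltW.
move: r1I; rewrite in_itv/= => /andP[r10 r11].
have r10' : 0 < r1.
  rewrite lt_neqAle r10 andbT; apply/eqP => r1E.
  by move: Gs; rewrite -r1E /G scale0r addr0; lra.
have r11' : r1 < 1.
  rewrite lt_neqAle r11 andbT; apply/eqP => r1E.
  by move: Gs; rewrite r1E /G scale1r addrC subrK; lra.
have ab0 : (b - a) 0 0 != 0.
  apply/eqP => ab; have ab' : b - a = 0 by rewrite [LHS]row1E ab scale0r.
  by move: wta; rewrite /m ab' scaler0 addr0 ltxx.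
pose x1 := a + r1 *: (b - a).
apply: (@no_local_min t y x1); first by rewrite t0.
(* In dimension one the open segment is a neighborhood of [x1]; [e] is the distance from [x1] to the
   nearer endpoint. *)
pose e := Num.min r1 (1 - r1) * `|(b - a) 0 0|.
apply/nearP; exists e.
  by rewrite mulr_gt0 ?normr_gt0// lt_min r10' subr_gt0.
move=> z; rewrite norm1E -ltr_pdivrMr ?normr_gt0// -normfV -normrM.
pose dr := (z - x1) 0 0 / (b - a) 0 0; rewrite -/dr lt_min => /andP[z1 z2].
have zE : z = a + (r1 + dr) *: (b - a).
  rewrite scalerDl addrA -/x1.
  have -> : dr *: (b - a) = z - x1.
    by rewrite [b - a]row1E scalerA /dr divfK// -row1E.
  by rewrite addrC subrK.
have : wt x1 <= wt z; last by [].
rewrite zE; apply: hr1; rewrite in_itv/=.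
move: z1 z2; rewrite !ltr_norml => /andP[lo _] /andP[_ hi].
by rewrite -lerBlDl sub0r -lerBrDl !ltW.
Qed.

Lemma strict_monotone (q q' : V) : q != q' -> 0 < dot (DL q' - DL q) (q' - q).
Proof.
move=> qq; rewrite lt_neqAle; apply/andP; split.
  apply: contra qq; rewrite eq_sym dot1E mulf_eq0 => /orP[] /eqP D0.
    have : DL q' - DL q = 0 by rewrite [LHS]row1E D0 scale0r.
    by move/eqP; rewrite subr_eq0 => /eqP DE; rewrite -(DLK P q) -(DLK P q') DE.
  have : q' - q = 0 by rewrite [LHS]row1E D0 scale0r.
  by move/eqP; rewrite subr_eq0 eq_sym.
have := legendre_subgradient P q q'; have := legendre_subgradient P q' q.
by rewrite dotBl -(opprB q' q) dotNl !(dotC (q' - q)); lra.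
Qed.

(* Moving [y] slightly towards the side of [z] opposite to [x] makes
   [cost T y] strictly steeper than [uT] at [z] in the direction of [x], so
   that [uT - cost T y] first decreases on the way from [z] to [x]. *)
Lemma touching_cost (z p : V) (k : R) : 0 <= k ->
  (forall x, uT x <= uT z + dot p (x - z) + k * dot (x - z) (x - z)) ->
  let y := z - T *: DH p in
  forall x, uT x - T * L (T^-1 *: (x - y)) <= uT z - T * L (T^-1 *: (z - y)).
Proof.
move=> k0 touch y0 x; rewrite leNgt; apply/negP => lt0.
pose w y x := uT x - T * L (T^-1 *: (x - y)).
have cw x' : continuous (fun y => w y x').
  apply: subr_cont; first exact: cst_cont.
  apply: mulr_cont; first exact: cst_cont.
  apply: comp_cont (legendre_continuous P).
  apply: scaler_cont; first exact: cst_cont.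
  by apply: subr_cont; [exact: cst_cont|move=> ?; exact: cvg_id].
have cww : continuous (fun y => w y x - w y z) by apply: subr_cont.
have w0 : 0 < w y0 x - w y0 z by rewrite subr_gt0.
have [d d0 hd] := (continuousP _ y0).1 (cww y0) _ w0.
have xz : x != z by apply: contraTneq lt0 => ->; rewrite ltxx.
have xz1 : 0 < 1 + `|x - z| by rewrite ltr_pwDl.
(* Small enough for [w y x] to remain above [w y z] after the shift of [y]. *)
pose eps := d / (1 + `|x - z|).
have eps0 : 0 < eps by rewrite divr_gt0.
pose y := y0 - eps *: (x - z).
have wyx : w y z < w y x.
  have := hd y; rewrite /y addrAC subrr add0r normrN normrZ gtr0_norm//.
  have -> : eps * `|x - z| < d.
    by rewrite /eps -mulrAC ltr_pdivrMr// mulrDr mulr1 ltrDr.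
  move=> /(_ isT); rewrite ltr_norml => /andP[+ _].
  by rewrite /= -subr_gt0 opprK subrK subr_gt0.
pose q0 := T^-1 *: (z - y0); pose q := T^-1 *: (z - y).
have q0E : q0 = DH p.
  by rewrite /q0 /y0 opprB addrC subrK scalerA mulVf ?gt_eqF// scale1r.
have qq0 : q - q0 = (eps / T) *: (x - z).
  rewrite /q /q0 /y; apply/rowP => i; rewrite !mxE; field.
  by rewrite gt_eqF.
pose D := dot (DL q - p) (x - z).
have D0 : 0 < D.
  have : q0 != q.
    rewrite eq_sym -subr_eq0 qq0 scaler_eq0 negb_or subr_eq0 xz andbT.
    by rewrite gt_eqF// divr_gt0.
  move/strict_monotone; rewrite qq0 dotZr {1}q0E (DHK P).
  by rewrite pmulr_rgt0// divr_gt0.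
pose X := dot (x - z) (x - z); have X0 : 0 <= X by exact: dotxx_ge0.
pose kX := 1 + k * X; have kX0 : 0 < kX by rewrite ltr_pwDl// mulr_ge0.
(* The gain in slope is [s * D] and the touching error [k * s ^+ 2 * X]; this [s] keeps the error
   within half of the gain. *)
pose s := Num.min (1 / 2) (D / 2 / kX).
have s0 : 0 < s by rewrite lt_min !divr_gt0.
have s1 : s < 1.
  have : s <= 1 / 2 by rewrite ge_min lexx.
  lra.
have sk : s * kX <= D / 2 by rewrite -ler_pdivlMr// ge_min lexx orbT.
have s01 : 0 < s < 1 by rewrite s0.
suff wm : w y (z + s *: (x - z)) < w y z.
  exact: (cost_quasiconcave s01 wm (lt_trans wm wyx)).
have := touch (z + s *: (x - z)).
have -> : z + s *: (x - z) - z = s *: (x - z) by rewrite addrAC subrr add0r.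
rewrite !dotZr dotZl -/X => up.
have := legendre_subgradient P q (T^-1 *: (z + s *: (x - z) - y)).
have -> : T^-1 *: (z + s *: (x - z) - y) - q = (s / T) *: (x - z).
  rewrite /q; apply/rowP => i; rewrite !mxE; field.
  by rewrite gt_eqF.
rewrite dotZl -(ler_pM2l T0) (dotC (x - z)).
have -> : T * (L q + s / T * dot (DL q) (x - z)) =
    T * L q + s * (D + dot p (x - z)).
  by rewrite /D dotBl; field; rewrite gt_eqF.
rewrite /w -/q => low.
have : s * (s * kX) <= s * (D / 2) by rewrite ler_pM2l.
have : 0 < s * D by rewrite mulr_gt0.
have : 0 < s * s by rewrite mulr_gt0.
rewrite /kX; lra.
Qed.

End one_dimensional_reachability.

Lemma one_dimensional_reachableP (R : realType) (H : 'rV[R]_1 -> R) (T : R)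
    (uT : 'rV[R]_1 -> R) :
  Ck 2 H -> (forall p, 0 < hessian H p 0 0) -> superlinear H ->
  0 < T -> lipschitz uT ->
  initial_data H T uT !=set0 <->
  viscosity_le0 (fun p X => X 0 0 - (T * hessian H p 0 0)^-1) uT.
Proof.
move=> H2 Hpos Hsup T0 uT_lip.
have [g gK] := choice (h1_surjective H2 Hpos Hsup).
have P := strictly_convex_pair H2 Hpos gK.
split=> [reach phi phi2 x lmin|visc].
  have /= := reachable_touched_above P T0
    (Q := fun p => ((hessian H p 0 0)^-1)%:M) (legendre_le_second H2 Hpos gK)
    reach phi2 lmin (const_mx 1).
  rewrite !dot1E mul_mx_scalar !mxE big_ord1 !mxE !mulr1 mul1r subr_le0 invfM.
  exact.
apply: (reachable_of_touching P T0 uT_lip) => z p k k0 touch.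
exact: (touching_cost P Hpos (legendre_ge_second H2 Hpos gK) T0 uT_lip visc k0 touch).
Qed.

Theorem theorem2p2 (R : realType) (n : nat) (uT : 'rV[R]_n.+1 -> R) (T : R)
    (uT_lip : lipschitz uT) (T_gt0 : 0 < T) :
  (forall H : 'rV[R]_n.+1 -> R, n.+1 = 1%N ->
     Ck 2 H ->
     (forall p, 0 < hessian H p 0 0) ->
     superlinear H ->
     (initial_data H T uT !=set0 <->
      viscosity_le0 (fun p X => X 0 0 - (T * hessian H p 0 0)^-1) uT))
  /\
  (forall A : 'M[R]_n.+1, A^T = A ->
     (forall p : 'rV[R]_n.+1, p != 0 -> 0 < quad A p) ->
     (initial_data (fun p => quad A p / 2) T uT !=set0 <->
      viscosity_le0 (fun _ X => lambda_max (X - T^-1 *: invmx A)) uT)).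
Proof.
split=> [H [n0] H2 Hpos Hsup|A AT A0]; last exact: quad_reachableP.
by subst n; exact: one_dimensional_reachableP.
Qed.
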